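(* Let $u\colon R\to U$ be an epimorphism of associative rings such that $\operatorname{Tor}^R_1(U,U)=0$. Then the restrictions of the adjoint functors $M\longmapsto \operatorname{Hom}_R(U/R,M)$ and $C\longmapsto (U/R)\otimes_R C$ are mutually inverse equivalences between the additive category of $u$-divisible left $u$-comodules $M$ and the additive category of $u$-torsionfree left $u$-contramodules $C$ (both viewed as full subcategories of the category of left $R$-modules).
   Context: Rings are associative and unital, not necessarily commutative. A ring homomorphism $u\colon R\to U$ is a ring epimorphism iff the multiplication map $U\otimes_R U\to U$ is an isomorphism. It is not assumed injective. $U$ is viewed as an $R$-$R$-bimodule via $u$, and $U/R$ denotes the cokernel of the map $u\colon R\to U$, an $R$-$R$-bimodule. For a left $R$-module $M$, the group $\operatorname{Hom}_R(U/R,M)$ (homomorphisms of left $R$-modules) is a left $R$-module via the right $R$-action on $U/R$. A left $R$-module $M$ is a (left) $u$-comodule if $U\otimes_R M=0=\operatorname{Tor}^R_1(U,M)$. A left $R$-module $C$ is a (left) $u$-contramodule if $\operatorname{Hom}_R(U,C)=0=\operatorname{Ext}^1_R(U,C)$. A left $R$-module $A$ is $u$-torsionfree if it is an $R$-submodule of a left $U$-module, equivalently, the map $A\to U\otimes_R A$ induced by $u$ is injective. A left $R$-module $B$ is $u$-divisible if it is a quotient $R$-module of a left $U$-module, equivalently, the map $\operatorname{Hom}_R(U,B)\to B$ induced by $u$ is surjective. *)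

(* Defs.v *)
From HB Require Import structures.
From mathcomp Require Import all_boot all_order all_algebra.
From mathcomp Require Import finmap.
From mathcomp.multinomials Require Import monalg.
From mathcomp Require Import boolp.

Set Implicit Arguments.
Unset Strict Implicit.
Unset Printing Implicit Defensive.
Import GRing.Theory.
Local Open Scope ring_scope.
Local Open Scope quotient_scope.

(* Rings are associative and unital, and may be trivial: [pzRingType]. *)

Reserved Notation "v *>r a" (at level 40, left associativity).

HB.mixin Record isRightModule (R : pzRingType) V of GRing.Zmodule V := {
  rscale : V -> R -> V;
  rscalerA : forall v a b, rscale (rscale v a) b = rscale v (a * b);
  rscaler1 : forall v, rscale v 1 = v;
  rscalerDl : forall a, {morph rscale^~ a : v w / v + w};
  rscalerDr : forall v, {morph rscale v : a b / a + b}
}.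

#[short(type="rmodType")]
HB.structure Definition RightModule (R : pzRingType) :=
  {V of GRing.Zmodule V & isRightModule R V}.

Notation "v *>r a" := (rscale v a) : ring_scope.

HB.mixin Record isBimodule (R S : pzRingType) V
    of GRing.Lmodule R V & RightModule S V := {
  bimodA : forall (a : R) (v : V) (b : S), (a *: v) *>r b = a *: (v *>r b)
}.

#[short(type="bimodType")]
HB.structure Definition Bimodule (R S : pzRingType) :=
  {V of GRing.Lmodule R V & RightModule S V & isBimodule R S V}.

Section RightModuleTheory.
Variables (R : pzRingType) (V : rmodType R).
Implicit Types (v : V) (a : R).

Lemma rscale0l a : (0 : V) *>r a = 0.
Proof. by apply: (addrI (0 *>r a)); rewrite -rscalerDl !addr0. Qed.

Lemma rscalerN v a : (- v) *>r a = - (v *>r a).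
Proof. by apply/eqP; rewrite -addr_eq0 -rscalerDl addNr rscale0l. Qed.

Lemma rscalerB v w a : (v - w) *>r a = v *>r a - w *>r a.
Proof. by rewrite rscalerDl rscalerN. Qed.

End RightModuleTheory.

Section Hom.
Variable (R : pzRingType).

Definition lhom (M N : lmodType R) := {linear M -> N}.

Definition mklhom (M N : lmodType R) (f : M -> N) (fL : linear f) : lhom M N :=
  HB.pack f (GRing.isLinear.Build R M N _ f fL).

Definition lid (M : lmodType R) : lhom M M := idfun.

Definition lcomp (M N P : lmodType R) (g : lhom N P) (f : lhom M N) :
  lhom M P := g \o f.

Lemma mklhomE (M N : lmodType R) (f : M -> N) (fL : linear f) x :
  mklhom fL x = f x.
Proof. by []. Qed.

Lemma lcompE (M N P : lmodType R) (g : lhom N P) (f : lhom M N) x :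
  lcomp g f x = g (f x).
Proof. by []. Qed.

HB.instance Definition _ (M N : lmodType R) := gen_eqMixin (lhom M N).
HB.instance Definition _ (M N : lmodType R) := gen_choiceMixin (lhom M N).

Section HomZmod.
Variables (M N : lmodType R).
Implicit Types f g h : lhom M N.

Lemma lhomP f g : (f : M -> N) =1 g -> f = g.
Proof.
case: f g => [f cf] [g cg] /= /funext fg.
case: _ / fg in cg *; congr GRing.Linear.Pack.
case: cf cg => [[cf1] [cf2]] [[cg1] [cg2]].
by rewrite (Prop_irrelevance cf2 cg2) (_ : cf1 = cg1) //; case: cf1 cg1
  => [a b] [c d]; rewrite (Prop_irrelevance a c) (Prop_irrelevance b d).
Qed.

Definition lhom0 : lhom M N := \0.
Definition lhomN f : lhom M N := \- f.
Definition lhomD f g : lhom M N := f \+ g.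

Fact lhomDA : associative lhomD.
Proof. by move=> f g h; apply: lhomP => x /=; rewrite addrA. Qed.
Fact lhomDC : commutative lhomD.
Proof. by move=> f g; apply: lhomP => x /=; rewrite addrC. Qed.
Fact lhom0D : left_id lhom0 lhomD.
Proof. by move=> f; apply: lhomP => x /=; rewrite add0r. Qed.
Fact lhomND : left_inverse lhom0 lhomN lhomD.
Proof. by move=> f; apply: lhomP => x /=; rewrite addNr. Qed.

HB.instance Definition _ :=
  GRing.isZmodule.Build (lhom M N) lhomDA lhomDC lhom0D lhomND.

Lemma lhom_addE f g x : (f + g) x = f x + g x. Proof. by []. Qed.
Lemma lhom_oppE f x : (- f) x = - f x. Proof. by []. Qed.
Lemma lhom_zeroE x : (0 : lhom M N) x = 0. Proof. by []. Qed.

End HomZmod.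
End Hom.

Notation "g \oL f" := (lcomp g f) (at level 50, left associativity).

(* For an R-S-bimodule X, the right action of S on X makes Hom_R(X, M) a left
   S-module: (s *: f) x = f (x *>r s). *)
Definition bihom (R S : pzRingType) (X : bimodType R S) (M : lmodType R) :=
  lhom X M.

Section BiHom.
Variables (R S : pzRingType) (X : bimodType R S) (M : lmodType R).
Implicit Types (f g : bihom X M) (s t : S).

HB.instance Definition _ := GRing.Zmodule.on (bihom X M).

Fact bihom_scale_linear s f : linear (fun x : X => f (x *>r s)).
Proof. by move=> a x y; rewrite rscalerDl bimodA linearP. Qed.

Definition bihom_scale s f : bihom X M := mklhom (bihom_scale_linear s f).

Fact bihom_scaleA s t f :
  bihom_scale s (bihom_scale t f) = bihom_scale (s * t) f.
Proof. by apply: lhomP => x /=; rewrite rscalerA. Qed.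
Fact bihom_scale1 : left_id 1 bihom_scale.
Proof. by move=> f; apply: lhomP => x /=; rewrite rscaler1. Qed.
Fact bihom_scaleDr : right_distributive bihom_scale +%R.
Proof. by move=> s f g; apply: lhomP => x. Qed.
Fact bihom_scaleDl f : {morph bihom_scale^~ f : s t / s + t}.
Proof. by move=> s t; apply: lhomP => x /=; rewrite rscalerDr linearD. Qed.

HB.instance Definition _ := GRing.Zmodule_isLmodule.Build S (bihom X M)
  bihom_scaleA bihom_scale1 bihom_scaleDr bihom_scaleDl.

Lemma bihom_scaleE s f x : (s *: f) x = f (x *>r s). Proof. by []. Qed.

End BiHom.

Section MalgLift.
Variables (K : choiceType) (G A : zmodType) (h : K -> {additive G -> A}).

Definition malg_lift (f : {malg G[K]}) : A := \sum_(k <- msupp f) h k f@_k.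

Lemma malg_liftEw (D : {fset K}) f : (msupp f `<=` D)%fset ->
  malg_lift f = \sum_(k <- D) h k f@_k.
Proof.
move=> sfD; apply: big_fset_incl => // k _ /mcoeff_outdom ->.
exact: raddf0.
Qed.

Lemma malg_lift_is_additive : zmod_morphism malg_lift.
Proof.
move=> f g; pose D := (msupp f `|` msupp g)%fset.
rewrite !(@malg_liftEw D) ?fsubsetUl ?fsubsetUr ?msuppB_le // -sumrB.
by apply: eq_bigr => k _; rewrite mcoeffB raddfB.
Qed.

HB.instance Definition _ :=
  GRing.isZmodMorphism.Build {malg G[K]} A malg_lift malg_lift_is_additive.

Lemma malg_liftU k x : malg_lift << x *g k >> = h k x.
Proof.
rewrite (@malg_liftEw [fset k]%fset) ?msuppU_le // big_seq_fset1.
by rewrite mcoeffUU.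
Qed.

End MalgLift.

(* The free left R-module on a set: the library's left module structure on
   {malg R[K]} is restricted to nontrivial rings. *)
Definition freemod (R : pzRingType) (K : choiceType) := {malg R[K]}.

Section FreeModule.
Variables (R : pzRingType) (K : choiceType).
Implicit Types (f g : freemod R K) (a b : R).

HB.instance Definition _ := GRing.Zmodule.on (freemod R K).

Definition free_scale a f : freemod R K :=
  \sum_(k <- msupp f) << a * f@_k *g k >>.

Lemma free_scaleE a f k : (free_scale a f)@_k = a * f@_k.
Proof.
rewrite [in RHS](monalgE f) !raddf_sum mulr_sumr.
by apply: eq_bigr => i _ /=; rewrite !mcoeffU mulrnAr.
Qed.

Fact free_scaleA a b f : free_scale a (free_scale b f) = free_scale (a * b) f.
Proof. by apply/malgP => k; rewrite !free_scaleE mulrA. Qed.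
Fact free_scale1 : left_id 1 free_scale.
Proof. by move=> f; apply/malgP => k; rewrite !free_scaleE mul1r. Qed.
Fact free_scaleDr : right_distributive free_scale +%R.
Proof.
by move=> a f g; apply/malgP => k; rewrite free_scaleE !mcoeffD !free_scaleE mulrDr.
Qed.
Fact free_scaleDl f : {morph free_scale^~ f : a b / a + b}.
Proof.
by move=> a b; apply/malgP => k; rewrite mcoeffD !free_scaleE mulrDl.
Qed.

HB.instance Definition _ := GRing.Zmodule_isLmodule.Build R (freemod R K)
  free_scaleA free_scale1 free_scaleDr free_scaleDl.

Definition free_gen (k : K) : freemod R K := locked << 1 *g k >>.

Lemma free_scale_genE a k : a *: free_gen k = << a *g k >>.
Proof.
rewrite /free_gen -lock; apply/malgP => l.
by rewrite free_scaleE !mcoeffU mulrnAr mulr1.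
Qed.

Section FreeLift.
Variables (M : lmodType R) (g : K -> M).

Fact scale_gen_is_additive k : zmod_morphism (fun a : R => a *: g k).
Proof. by move=> a b; rewrite scalerBl. Qed.

Definition scale_gen k : {additive R -> M} :=
  HB.pack (fun a : R => a *: g k)
    (GRing.isZmodMorphism.Build R M _ (scale_gen_is_additive k)).

Definition free_lift_fun (f : freemod R K) : M := locked (malg_lift scale_gen f).

Fact free_lift_linear : linear free_lift_fun.
Proof.
move=> a x y; rewrite /free_lift_fun -!lock raddfD /=; congr (_ + _).
have sub : (msupp (a *: x : freemod R K) `<=` msupp x)%fset.
  apply/fsubsetP => k; rewrite -!mcoeff_neq0 free_scaleE.
  by apply: contra_neq => ->; rewrite mulr0.
rewrite (malg_liftEw _ sub) /malg_lift scaler_sumr.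
by apply: eq_bigr => k _ /=; rewrite free_scaleE scalerA.
Qed.

Definition free_lift : lhom (freemod R K) M := mklhom free_lift_linear.

Lemma free_lift_gen k : free_lift (free_gen k) = g k.
Proof.
by rewrite mklhomE /free_lift_fun /free_gen -!lock malg_liftU /= scale1r.
Qed.

End FreeLift.

Lemma free_hom_ext (M : lmodType R) (f h : lhom (freemod R K) M) :
  (forall k, f (free_gen k) = h (free_gen k)) -> f = h.
Proof.
move=> fh; apply: lhomP => x; rewrite [x]monalgE !linear_sum.
by apply: eq_bigr => k _; rewrite /= -free_scale_genE !linearZ /= fh.
Qed.

End FreeModule.

Definition subgroup_gen (V : zmodType) (P : V -> Prop) : {pred V} := fun v =>
  `[< forall H : {pred V},
        zmod_closed H -> (forall w, P w -> w \in H) -> v \in H >].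

Section SubgroupGen.
Variables (V : zmodType) (P : V -> Prop).

Fact subgroup_gen_closed : zmod_closed (subgroup_gen P).
Proof.
split=> [|x y /asboolP Hx /asboolP Hy]; apply/asboolP => H cH PH.
  exact: cH.1.
by apply: cH.2; [apply: Hx | apply: Hy].
Qed.

HB.instance Definition _ :=
  GRing.isZmodClosed.Build V (subgroup_gen P) subgroup_gen_closed.

Lemma mem_subgroup_gen v : P v -> v \in subgroup_gen P.
Proof. by move=> Pv; apply/asboolP => H _; apply. Qed.

End SubgroupGen.

Definition freeab (K : choiceType) : zmodType := {malg int[K]}.

Definition freeab_gen (K : choiceType) (k : K) : freeab K := << (1 : int) *g k >>.

Section Tensor.
Variables (S : pzRingType) (X : rmodType S) (M : lmodType S).

Definition tensor_gen (x : X) (m : M) := @freeab_gen (X * M)%type (x, m).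
Local Notation gen := tensor_gen.

Variant tensor_relator : freeab (X * M)%type -> Prop :=
| TensorAddl x y m : tensor_relator (gen (x + y) m - gen x m - gen y m)
| TensorAddr x m n : tensor_relator (gen x (m + n) - gen x m - gen x n)
| TensorBalanced x s m : tensor_relator (gen (x *>r s) m - gen x (s *: m)).

(* The right S-module X tensored with the left S-module M over S *)
Definition tensor := Quotient.quot (subgroup_gen tensor_relator).

HB.instance Definition _ := GRing.Zmodule.on tensor.

Definition tens (x : X) (m : M) : tensor := locked (\pi_tensor (gen x m)).

Lemma tensE x m : tens x m = \pi_tensor (gen x m).
Proof. by rewrite /tens -lock. Qed.

Lemma pi_tensor_eq a b : a - b \in subgroup_gen tensor_relator ->
  \pi_tensor a = \pi_tensor b.
Proof. by move=> ab; apply/eqP; rewrite -Quotient.idealrBE. Qed.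

Lemma tensDl x y m : tens (x + y) m = tens x m + tens y m.
Proof.
rewrite !tensE -raddfD; apply: pi_tensor_eq; rewrite opprD addrA.
exact/mem_subgroup_gen/TensorAddl.
Qed.

Lemma tensDr x m n : tens x (m + n) = tens x m + tens x n.
Proof.
rewrite !tensE -raddfD; apply: pi_tensor_eq; rewrite opprD addrA.
exact/mem_subgroup_gen/TensorAddr.
Qed.

Lemma tens_bal x s m : tens (x *>r s) m = tens x (s *: m).
Proof. by rewrite !tensE; exact/pi_tensor_eq/mem_subgroup_gen/TensorBalanced. Qed.

Lemma tens0l m : tens 0 m = 0.
Proof. by apply: (addrI (tens 0 m)); rewrite -tensDl !addr0. Qed.

Lemma tens0r x : tens x 0 = 0.
Proof. by apply: (addrI (tens x 0)); rewrite -tensDr !addr0. Qed.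

Lemma tensNl x m : tens (- x) m = - tens x m.
Proof. by apply/eqP; rewrite -addr_eq0 -tensDl addNr tens0l. Qed.

Lemma tensNr x m : tens x (- m) = - tens x m.
Proof. by apply/eqP; rewrite -addr_eq0 -tensDr addNr tens0r. Qed.

Lemma tensor_ind (P : tensor -> Prop) :
  (forall x m, P (tens x m)) -> (forall s t, P s -> P t -> P (s + t)) ->
  forall t, P t.
Proof.
move=> Pt PD t; have P0 : P 0 by rewrite -(tens0l 0).
rewrite -[t]reprK [repr t]monalgE raddf_sum /=.
apply: (big_ind P) => // -[x m] _; move: (_@_(x, m)) => z.
have Pn n : P (\pi_tensor << n%:Z *g (x, m) >>).
  elim: n => [|n IHn]; first by rewrite monalgU0 raddf0.
  rewrite intS monalgUD raddfD; apply: PD => //.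
  by have := Pt x m; rewrite tensE.
have PN n : P (\pi_tensor << - n%:Z *g (x, m) >>).
  elim: n => [|n IHn]; first by rewrite oppr0 monalgU0 raddf0.
  rewrite intS opprD monalgUD raddfD; apply: PD => //.
  by have := Pt (- x) m; rewrite tensNl tensE -raddfN -[- gen x m]monalgUN.
by case: (intP z) => [|n|n]; [exact: (Pn 0%N)|exact: Pn|exact: PN].
Qed.

Section Lift.
Variables (A : zmodType) (b : X -> M -> A).
Hypothesis bDl : forall x y m, b (x + y) m = b x m + b y m.
Hypothesis bDr : forall x m n, b x (m + n) = b x m + b x n.
Hypothesis b_bal : forall x s m, b (x *>r s) m = b x (s *: m).

Let bz (p : X * M) (z : int) : A := b p.1 p.2 *~ z.

Fact bz_is_additive p : zmod_morphism (bz p).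
Proof. by move=> y z; rewrite /bz mulrzBr. Qed.

Let bza p : {additive int -> A} :=
  HB.pack (bz p) (GRing.isZmodMorphism.Build int A _ (bz_is_additive p)).

(* The hypotheses are arguments, for the additive structure to be inferred. *)
Definition tensor_lift
    (_ : forall x y m, b (x + y) m = b x m + b y m)
    (_ : forall x m n, b x (m + n) = b x m + b x n)
    (_ : forall x s m, b (x *>r s) m = b x (s *: m)) (t : tensor) : A :=
  locked (malg_lift bza (repr t)).

Local Notation lift := (tensor_lift bDl bDr b_bal).

Fact tensor_lift_pi f : lift (\pi_tensor f) = malg_lift bza f.
Proof.
have ker g : g \in subgroup_gen tensor_relator -> malg_lift bza g = 0.
  move/asboolP/(_ [pred g | malg_lift bza g == 0]) => H.
  apply/eqP; apply: H.
    split=> [|x y]; rewrite !inE ?raddf0 // => /eqP hx /eqP hy.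
    by rewrite raddfB /= hx hy subr0.
  move=> _ [x y m|x m n|x s m]; rewrite inE !raddfB /= !malg_liftU /= /bz /= !mulr1z.
  - by rewrite bDl addrAC addrK subrr.
  - by rewrite bDr addrAC addrK subrr.
  - by rewrite b_bal subrr.
rewrite /tensor_lift -lock.
apply/eqP; rewrite -subr_eq0 -raddfB; apply/eqP/ker.
by rewrite Quotient.idealrBE reprK.
Qed.

Fact tensor_lift_is_additive : zmod_morphism lift.
Proof.
move=> s t; rewrite -[s]reprK -[t]reprK -raddfB !tensor_lift_pi.
exact: raddfB.
Qed.

HB.instance Definition _ :=
  GRing.isZmodMorphism.Build tensor A lift tensor_lift_is_additive.

Lemma tensor_liftE x m : lift (tens x m) = b x m.
Proof. by rewrite tensE tensor_lift_pi malg_liftU /= /bz mulr1z. Qed.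

End Lift.

Lemma tensor_ext (A : zmodType) (f g : {additive tensor -> A}) :
  (forall x m, f (tens x m) = g (tens x m)) -> f =1 g.
Proof.
by move=> fg; apply: tensor_ind => // s t fs ft; rewrite !raddfD fs ft.
Qed.

End Tensor.

Section TensorMap.
Variables (S : pzRingType) (X : rmodType S) (M N : lmodType S) (f : lhom M N).

Fact tensor_map_Dl (x y : X) m :
  tens (x + y) (f m) = tens x (f m) + tens y (f m).
Proof. exact: tensDl. Qed.
Fact tensor_map_Dr (x : X) m n :
  tens x (f (m + n)) = tens x (f m) + tens x (f n).
Proof. by rewrite linearD tensDr. Qed.
Fact tensor_map_bal (x : X) s m : tens (x *>r s) (f m) = tens x (f (s *: m)).
Proof. by rewrite linearZ tens_bal. Qed.

Definition tensor_map : tensor X M -> tensor X N :=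
  tensor_lift tensor_map_Dl tensor_map_Dr tensor_map_bal.

HB.instance Definition _ := GRing.Additive.on tensor_map.

Lemma tensor_mapE x m : tensor_map (tens x m) = tens x (f m).
Proof. exact: tensor_liftE. Qed.

End TensorMap.

Arguments tensor_map {S} X {M N} f.

(* For an R-S-bimodule X, the left action of R on X makes X (x)_S M a left
   R-module: a *: (x (x) m) = (a *: x) (x) m. *)
Definition bitensor (R S : pzRingType) (X : bimodType R S) (M : lmodType S) :=
  tensor X M.

Section BiTensor.
Variables (R S : pzRingType) (X : bimodType R S).

Section Lmodule.
Variable M : lmodType S.
Implicit Types (a b : R) (s t : bitensor X M).

HB.instance Definition _ := GRing.Zmodule.on (bitensor X M).

Lemma bitensor_ind (P : bitensor X M -> Prop) :
  (forall x m, P (tens x m)) -> (forall s t, P s -> P t -> P (s + t)) ->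
  forall t, P t.
Proof. exact: tensor_ind. Qed.

Fact bitensor_scale_Dl a (x y : X) (m : M) :
  tens (a *: (x + y)) m = tens (a *: x) m + tens (a *: y) m.
Proof. by rewrite scalerDr tensDl. Qed.
Fact bitensor_scale_Dr a (x : X) (m n : M) :
  tens (a *: x) (m + n) = tens (a *: x) m + tens (a *: x) n.
Proof. exact: tensDr. Qed.
Fact bitensor_scale_bal a (x : X) (c : S) (m : M) :
  tens (a *: (x *>r c)) m = tens (a *: x) (c *: m).
Proof. by rewrite -bimodA tens_bal. Qed.

Definition bitensor_scale a : bitensor X M -> bitensor X M :=
  tensor_lift (bitensor_scale_Dl a) (bitensor_scale_Dr a)
    (bitensor_scale_bal a).

HB.instance Definition _ a := GRing.Additive.on (bitensor_scale a).

Lemma bitensor_scale_tens a (x : X) (m : M) :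
  bitensor_scale a (tens x m) = tens (a *: x) m.
Proof. exact: tensor_liftE. Qed.

Fact bitensor_scaleA a b t :
  bitensor_scale a (bitensor_scale b t) = bitensor_scale (a * b) t.
Proof.
elim/bitensor_ind: t => [x m|s t Hs Ht].
  by rewrite !bitensor_scale_tens scalerA.
by rewrite !raddfD /= Hs Ht.
Qed.
Fact bitensor_scale1 : left_id 1 bitensor_scale.
Proof.
elim/bitensor_ind => [x m|s t Hs Ht]; first by rewrite bitensor_scale_tens scale1r.
by rewrite raddfD /= Hs Ht.
Qed.
Fact bitensor_scaleDr : right_distributive bitensor_scale +%R.
Proof. by move=> a s t; rewrite raddfD. Qed.
Fact bitensor_scaleDl t : {morph bitensor_scale^~ t : a b / a + b}.
Proof.
move=> a b; elim/bitensor_ind: t => [x m|s t Hs Ht].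
  by rewrite !bitensor_scale_tens scalerDl tensDl.
by rewrite !raddfD /= Hs Ht; exact: addrACA.
Qed.

HB.instance Definition _ := GRing.Zmodule_isLmodule.Build R (bitensor X M)
  bitensor_scaleA bitensor_scale1 bitensor_scaleDr bitensor_scaleDl.

Lemma bitensorZ a (x : X) (m : M) :
  a *: (tens x m : bitensor X M) = tens (a *: x) m.
Proof. exact: bitensor_scale_tens. Qed.

End Lmodule.

Section Map.
Variables (M N : lmodType S) (f : lhom M N).

Fact bitensor_map_linear :
  linear (tensor_map X f : bitensor X M -> bitensor X N).
Proof.
have fZ a (s : bitensor X M) :
    tensor_map X f (a *: s) = a *: (tensor_map X f s : bitensor X N).
  elim/bitensor_ind: s => [x m|s t Hs Ht].
    by rewrite bitensorZ !tensor_mapE bitensorZ.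
  have fD (v w : bitensor X M) : tensor_map X f (v + w) =
      (tensor_map X f v : bitensor X N) + tensor_map X f w by exact: raddfD.
  by rewrite scalerDr !fD Hs Ht scalerDr.
by move=> a s t; rewrite [LHS]raddfD /= fZ.
Qed.

Definition bitensor_map : lhom (bitensor X M) (bitensor X N) :=
  mklhom bitensor_map_linear.

Lemma bitensor_mapE x m : bitensor_map (tens x m) = tens x (f m).
Proof. exact: tensor_mapE. Qed.

End Map.
End BiTensor.

Arguments bitensor_map {R S} X {M N} f.

Lemma bitensor_hom_ext (R S : pzRingType) (X : bimodType R S) (M : lmodType S)
    (N : lmodType R) (f g : lhom (bitensor X M) N) :
  (forall x m, f (tens x m) = g (tens x m)) -> f = g.
Proof.
move=> fg; apply: lhomP; apply: bitensor_ind => // s t fs ft.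
by rewrite !linearD fs ft.
Qed.

Section BiHomMap.
Variables (R S : pzRingType) (X : bimodType R S) (M N : lmodType R).
Variable f : lhom M N.

Fact bihom_map_linear :
  linear ((fun h => f \oL h) : bihom X M -> bihom X N).
Proof. by move=> s g h; apply: lhomP => x /=; rewrite linearD. Qed.

Definition bihom_map : lhom (bihom X M) (bihom X N) := mklhom bihom_map_linear.

Lemma bihom_mapE (h : bihom X M) x : bihom_map h x = f (h x).
Proof. by []. Qed.

End BiHomMap.

Arguments bihom_map {R S} X {M N} f.

Definition kertype (R : pzRingType) (M N : lmodType R) (f : lhom M N) :
  choiceType := {x : M | f x == 0}.

Definition to_ker (R : pzRingType) (M N : lmodType R) (f : lhom M N) x
  (fx : f x = 0) : kertype f := exist _ x (introT eqP fx).

Lemma kertypeP (R : pzRingType) (M N : lmodType R) (f : lhom M N)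
  (x : kertype f) : f (sval x) = 0.
Proof. exact/eqP/(svalP x). Qed.

(* The standard free resolution res2 -> res1 -> res0 -> M -> 0: each term is the
   free module on the underlying set of the kernel it has to cover. Vanishing of
   Tor_1 and Ext^1 is exactness, in degree 1, of its image under X (x)_R - and
   Hom_R(-, N). *)
Section Resolution.
Variables (R : pzRingType) (M : lmodType R).

Definition res0 : lmodType R := freemod R M.
Definition res_aug : lhom res0 M := free_lift id.

Definition res1 : lmodType R := freemod R (kertype res_aug).
Definition res_d1 : lhom res1 res0 := free_lift (fun p => sval p).

Definition res2 : lmodType R := freemod R (kertype res_d1).
Definition res_d2 : lhom res2 res1 := free_lift (fun p => sval p).

Lemma res_aug_surj m : exists p, res_aug p = m.
Proof. by exists (free_gen R m); rewrite free_lift_gen. Qed.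

Lemma res_aug_d1 : res_aug \oL res_d1 = 0.
Proof.
apply: free_hom_ext => p; rewrite lcompE free_lift_gen; exact: kertypeP.
Qed.

Lemma res_d1_exact p : res_aug p = 0 -> exists q, p = res_d1 q.
Proof. by move=> p0; exists (free_gen R (to_ker p0)); rewrite free_lift_gen. Qed.

Lemma res_d1_d2 : res_d1 \oL res_d2 = 0.
Proof.
apply: free_hom_ext => p; rewrite lcompE free_lift_gen; exact: kertypeP.
Qed.

Lemma res_d2_exact p : res_d1 p = 0 -> exists q, p = res_d2 q.
Proof. by move=> p0; exists (free_gen R (to_ker p0)); rewrite free_lift_gen. Qed.

End Resolution.

Definition Tor1_eq0 (R : pzRingType) (X : rmodType R) (M : lmodType R) : Prop :=
  forall t : tensor X (res1 M), tensor_map X (res_d1 M) t = 0 ->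
  exists s : tensor X (res2 M), t = tensor_map X (res_d2 M) s.

Definition Ext1_eq0 (R : pzRingType) (M N : lmodType R) : Prop :=
  forall f : lhom (res1 M) N, f \oL res_d2 M = 0 ->
  exists g : lhom (res0 M) N, f = g \oL res_d1 M.

Definition restr (R U : pzRingType) (u : {rmorphism R -> U}) (N : lmodType U) :
  Type := N.

Section Restriction.
Variables (R U : pzRingType) (u : {rmorphism R -> U}) (N : lmodType U).

HB.instance Definition _ := GRing.Zmodule.on (restr u N).

Definition restr_scale (a : R) (x : restr u N) : restr u N :=
  u a *: (x : N).

Fact restr_scaleA a b x :
  restr_scale a (restr_scale b x) = restr_scale (a * b) x.
Proof. by rewrite /restr_scale rmorphM scalerA. Qed.
Fact restr_scale1 : left_id 1 restr_scale.
Proof. by move=> x; rewrite /restr_scale rmorph1 scale1r. Qed.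
Fact restr_scaleDr : right_distributive restr_scale +%R.
Proof. by move=> a x y; exact: scalerDr. Qed.
Fact restr_scaleDl x : {morph restr_scale^~ x : a b / a + b}.
Proof. by move=> a b; rewrite /restr_scale rmorphD; exact: scalerDl. Qed.

HB.instance Definition _ := GRing.Zmodule_isLmodule.Build R (restr u N)
  restr_scaleA restr_scale1 restr_scaleDr restr_scaleDl.

End Restriction.

(* U as an R-R-bimodule via u *)
Definition ringbim (R U : pzRingType) (u : {rmorphism R -> U}) : Type := U.

Section RingBimodule.
Variables (R U : pzRingType) (u : {rmorphism R -> U}).
Implicit Types (x y : ringbim u) (a b : R).

HB.instance Definition _ := GRing.Zmodule.on (ringbim u).

Definition ringbim_lscale a x : ringbim u := u a * (x : U).
Definition ringbim_rscale x a : ringbim u := (x : U) * u a.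

Fact ringbim_lscaleA a b x :
  ringbim_lscale a (ringbim_lscale b x) = ringbim_lscale (a * b) x.
Proof. by rewrite /ringbim_lscale rmorphM mulrA. Qed.
Fact ringbim_lscale1 : left_id 1 ringbim_lscale.
Proof. by move=> x; rewrite /ringbim_lscale rmorph1 mul1r. Qed.
Fact ringbim_lscaleDr : right_distributive ringbim_lscale +%R.
Proof. by move=> a x y; exact: mulrDr. Qed.
Fact ringbim_lscaleDl x : {morph ringbim_lscale^~ x : a b / a + b}.
Proof. by move=> a b; rewrite /ringbim_lscale rmorphD; exact: mulrDl. Qed.

HB.instance Definition _ := GRing.Zmodule_isLmodule.Build R (ringbim u)
  ringbim_lscaleA ringbim_lscale1 ringbim_lscaleDr ringbim_lscaleDl.

Fact ringbim_rscaleA x a b :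
  ringbim_rscale (ringbim_rscale x a) b = ringbim_rscale x (a * b).
Proof. by rewrite /ringbim_rscale rmorphM mulrA. Qed.
Fact ringbim_rscale1 x : ringbim_rscale x 1 = x.
Proof. by rewrite /ringbim_rscale rmorph1 mulr1. Qed.
Fact ringbim_rscaleDl a : {morph ringbim_rscale^~ a : x y / x + y}.
Proof. by move=> x y; exact: mulrDl. Qed.
Fact ringbim_rscaleDr x : {morph ringbim_rscale x : a b / a + b}.
Proof. by move=> a b; rewrite /ringbim_rscale rmorphD; exact: mulrDr. Qed.

HB.instance Definition _ := isRightModule.Build R (ringbim u)
  ringbim_rscaleA ringbim_rscale1 ringbim_rscaleDl ringbim_rscaleDr.

Fact ringbim_bimodA a x b : (a *: x) *>r b = a *: (x *>r b).
Proof. by symmetry; exact: mulrA. Qed.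

HB.instance Definition _ := isBimodule.Build R R (ringbim u) ringbim_bimodA.

End RingBimodule.

Definition rimage (R U : pzRingType) (u : {rmorphism R -> U}) :
    {pred ringbim u} :=
  fun x => `[< exists r : R, u r = (x : U) >].
Arguments rimage {R U} u.

Section Cokernel.
Variables (R U : pzRingType) (u : {rmorphism R -> U}).

Fact rimage_closed : zmod_closed (rimage u).
Proof.
split=> [|x y /asboolP[a <-] /asboolP[b <-]]; apply/asboolP.
  by exists 0; rewrite rmorph0.
by exists (a - b); rewrite rmorphB.
Qed.

HB.instance Definition _ :=
  GRing.isZmodClosed.Build (ringbim u) (rimage u) rimage_closed.

(* U/R *)
Definition coker := Quotient.quot (rimage u).

HB.instance Definition _ := GRing.Zmodule.on coker.

Implicit Types (x y : coker) (a b : R).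

Lemma pi_coker_eq0 (x : ringbim u) : (\pi_coker x == 0) = (x \in rimage u).
Proof.
rewrite -[in RHS](subr0 x) Quotient.idealrBE.
by rewrite -(raddf0 (\pi_coker)).
Qed.

Lemma pi_coker_eq (x y : ringbim u) :
  x - y \in rimage u -> \pi_coker x = \pi_coker y.
Proof. by move=> xy; apply/eqP; rewrite -Quotient.idealrBE. Qed.

Lemma coker_ind (P : coker -> Prop) :
  (forall x : ringbim u, P (\pi_coker x)) -> forall x, P x.
Proof. by move=> H x; rewrite -[x]reprK. Qed.

Definition coker_lscale a x : coker := \pi_coker (a *: (repr x : ringbim u)).
Definition coker_rscale x a : coker := \pi_coker ((repr x : ringbim u) *>r a).

Lemma repr_pi_coker (x : ringbim u) :
  exists r, repr (\pi_coker x) = x + u r :> ringbim u.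
Proof.
have /asboolP[r ur] : (repr (\pi_coker x) : ringbim u) - x \in rimage u.
  by rewrite Quotient.idealrBE reprK.
by exists r; rewrite ur addrC subrK.
Qed.

Lemma coker_lscale_pi a (x : ringbim u) :
  coker_lscale a (\pi_coker x) = \pi_coker (a *: x).
Proof.
rewrite /coker_lscale; have [r ->] := repr_pi_coker x.
apply: pi_coker_eq; rewrite scalerDr addrAC subrr add0r.
by apply/asboolP; exists (a * r); rewrite rmorphM.
Qed.

Lemma coker_rscale_pi (x : ringbim u) a :
  coker_rscale (\pi_coker x) a = \pi_coker (x *>r a).
Proof.
rewrite /coker_rscale; have [r ->] := repr_pi_coker x.
apply: pi_coker_eq; rewrite rscalerDl addrAC subrr add0r.
by apply/asboolP; exists (r * a); rewrite rmorphM.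
Qed.

Fact coker_lscaleA a b x :
  coker_lscale a (coker_lscale b x) = coker_lscale (a * b) x.
Proof. by elim/coker_ind: x => x; rewrite !coker_lscale_pi scalerA. Qed.
Fact coker_lscale1 : left_id 1 coker_lscale.
Proof. by elim/coker_ind => x; rewrite coker_lscale_pi scale1r. Qed.
Fact coker_lscaleDr : right_distributive coker_lscale +%R.
Proof.
move=> a; elim/coker_ind => x; elim/coker_ind => y.
by rewrite -raddfD !coker_lscale_pi scalerDr raddfD.
Qed.
Fact coker_lscaleDl x : {morph coker_lscale^~ x : a b / a + b}.
Proof.
move=> a b; elim/coker_ind: x => x.
by rewrite !coker_lscale_pi scalerDl raddfD.
Qed.

HB.instance Definition _ := GRing.Zmodule_isLmodule.Build R coker
  coker_lscaleA coker_lscale1 coker_lscaleDr coker_lscaleDl.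

Fact coker_rscaleA x a b :
  coker_rscale (coker_rscale x a) b = coker_rscale x (a * b).
Proof. by elim/coker_ind: x => x; rewrite !coker_rscale_pi rscalerA. Qed.
Fact coker_rscale1 x : coker_rscale x 1 = x.
Proof. by elim/coker_ind: x => x; rewrite coker_rscale_pi rscaler1. Qed.
Fact coker_rscaleDl a : {morph coker_rscale^~ a : x y / x + y}.
Proof.
elim/coker_ind => x; elim/coker_ind => y.
by rewrite -raddfD !coker_rscale_pi rscalerDl raddfD.
Qed.
Fact coker_rscaleDr x : {morph coker_rscale x : a b / a + b}.
Proof.
move=> a b; elim/coker_ind: x => x.
by rewrite !coker_rscale_pi rscalerDr raddfD.
Qed.

HB.instance Definition _ := isRightModule.Build R coker
  coker_rscaleA coker_rscale1 coker_rscaleDl coker_rscaleDr.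

Lemma coker_lscaleE a (x : ringbim u) :
  a *: (\pi_coker x : coker) = \pi_coker (a *: x).
Proof. exact: coker_lscale_pi. Qed.
Lemma coker_rscaleE a (x : ringbim u) :
  (\pi_coker x : coker) *>r a = \pi_coker (x *>r a).
Proof. exact: coker_rscale_pi. Qed.

Fact coker_bimodA a x b : (a *: x) *>r b = a *: (x *>r b).
Proof.
elim/coker_ind: x => x.
by rewrite coker_lscaleE !coker_rscaleE coker_lscaleE bimodA.
Qed.

HB.instance Definition _ := isBimodule.Build R R coker coker_bimodA.

End Cokernel.

Section UModules.
Variables (R U : pzRingType) (u : {rmorphism R -> U}).

(* See ring_epiP below for the criterion that U (x)_R U -> U is bijective. *)
Definition ring_epi : Prop :=
  forall (S : pzRingType) (f g : {rmorphism U -> S}),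
  (forall r, f (u r) = g (u r)) -> f =1 g.

(* U (x)_R M = 0 = Tor_1^R(U, M) *)
Definition is_comodule (M : lmodType R) : Prop :=
  (forall t : tensor (ringbim u) M, t = 0) /\ Tor1_eq0 (ringbim u) M.

(* Hom_R(U, C) = 0 = Ext^1_R(U, C) *)
Definition is_contramodule (C : lmodType R) : Prop :=
  (forall f : lhom (ringbim u) C, f = 0) /\ Ext1_eq0 (ringbim u) C.

Definition is_torsionfree (A : lmodType R) : Prop :=
  exists (N : lmodType U) (f : lhom A (restr u N)), injective f.

Definition is_divisible (B : lmodType R) : Prop :=
  exists (N : lmodType U) (f : lhom (restr u N) B), forall b, exists n, f n = b.

Definition is_divisible_comodule M := is_divisible M /\ is_comodule M.

Definition is_torsionfree_contramodule C :=
  is_torsionfree C /\ is_contramodule C.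

End UModules.

#[local] Obligation Tactic := idtac.

Record preadditive := Preadditive {
  obj :> Type;
  hom : obj -> obj -> zmodType;
  idm : forall x, hom x x;
  mcomp : forall x y z, hom y z -> hom x y -> hom x z;
  mcompA : forall w x y z (f : hom y z) (g : hom x y) (h : hom w x),
    mcomp f (mcomp g h) = mcomp (mcomp f g) h;
  mcomp1m : forall x y (f : hom x y), mcomp (idm y) f = f;
  mcompm1 : forall x y (f : hom x y), mcomp f (idm x) = f;
  mcompDl : forall x y z (f g : hom y z) (h : hom x y),
    mcomp (f + g) h = mcomp f h + mcomp g h;
  mcompDr : forall x y z (f : hom y z) (g h : hom x y),
    mcomp f (g + h) = mcomp f g + mcomp f h
}.

Arguments idm {p} x.
Arguments mcomp {p x y z} f g.

Notation "f \c g" := (mcomp f g) (at level 40, left associativity).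

Record functor (C D : preadditive) := Functor {
  fob :> C -> D;
  fmap : forall x y, hom x y -> hom (fob x) (fob y);
  fmap1 : forall x, fmap (idm x) = idm (fob x);
  fmapM : forall x y z (f : hom y z) (g : hom x y),
    fmap (f \c g) = fmap f \c fmap g;
  fmapD : forall x y (f g : hom x y), fmap (f + g) = fmap f + fmap g
}.

Arguments fmap {C D} F {x y} f : rename.

Definition functor_id (C : preadditive) : functor C C :=
  @Functor C C id (fun _ _ f => f) (fun _ => erefl) (fun _ _ _ _ _ => erefl)
    (fun _ _ _ _ => erefl).

Program Definition functor_comp (C D E : preadditive) (G : functor D E)
    (F : functor C D) : functor C E :=
  @Functor C E (fun x => G (F x)) (fun _ _ f => fmap G (fmap F f)) _ _ _.
Next Obligation. by move=> * /=; rewrite !fmap1. Qed.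
Next Obligation. by move=> * /=; rewrite !fmapM. Qed.
Next Obligation. by move=> * /=; rewrite !fmapD. Qed.

Record nat_iso (C D : preadditive) (F G : functor C D) := NatIso {
  iso_to : forall x, hom (F x) (G x);
  iso_from : forall x, hom (G x) (F x);
  iso_toK : forall x, iso_from x \c iso_to x = idm (F x);
  iso_fromK : forall x, iso_to x \c iso_from x = idm (G x);
  iso_natural : forall x y (f : hom x y),
    iso_to y \c fmap F f = fmap G f \c iso_to x
}.

Definition inverse_equivalences (C D : preadditive) (F : functor C D)
    (G : functor D C) : Prop :=
  inhabited (nat_iso (functor_comp G F) (functor_id C)) /\
  inhabited (nat_iso (functor_comp F G) (functor_id D)).

Record adjunction (C D : preadditive) (F : functor C D) (G : functor D C) :=
  Adjunction {
  adj_unit : forall x, hom x (G (F x));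
  adj_counit : forall y, hom (F (G y)) y;
  adj_unit_natural : forall x x' (f : hom x x'),
    adj_unit x' \c f = fmap G (fmap F f) \c adj_unit x;
  adj_counit_natural : forall y y' (f : hom y y'),
    f \c adj_counit y = adj_counit y' \c fmap F (fmap G f);
  adj_triangle_l : forall x,
    adj_counit (F x) \c fmap F (adj_unit x) = idm (F x);
  adj_triangle_r : forall y,
    fmap G (adj_counit y) \c adj_unit (G y) = idm (G y)
}.

Section FullSubcategory.
Variables (C : preadditive) (P : C -> Prop).

Program Definition full_subcat : preadditive :=
  @Preadditive {x : C | P x} (fun x y => hom (sval x) (sval y))
    (fun x => idm (sval x)) (fun _ _ _ f g => f \c g) _ _ _ _ _.
Next Obligation. by move=> *; exact: mcompA. Qed.
Next Obligation. by move=> *; exact: mcomp1m. Qed.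
Next Obligation. by move=> *; exact: mcompm1. Qed.
Next Obligation. by move=> *; exact: mcompDl. Qed.
Next Obligation. by move=> *; exact: mcompDr. Qed.

End FullSubcategory.

Section Restrict.
Variables (C D : preadditive) (P : C -> Prop) (Q : D -> Prop).
Variables (F : functor C D) (PQ : forall x, P x -> Q (F x)).

Program Definition restrict : functor (full_subcat P) (full_subcat Q) :=
  @Functor (full_subcat P) (full_subcat Q)
    (fun x => exist _ (F (sval x)) (PQ (svalP x))) (fun _ _ f => fmap F f) _ _ _.
Next Obligation. by move=> *; exact: fmap1. Qed.
Next Obligation. by move=> *; exact: fmapM. Qed.
Next Obligation. by move=> *; exact: fmapD. Qed.

End Restrict.

Arguments restrict {C D P Q} F PQ.

Program Definition LMod (R : pzRingType) : preadditive :=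
  @Preadditive (lmodType R) (fun M N => lhom M N) (@lid R) (@lcomp R)
    _ _ _ _ _.
Next Obligation. by move=> *; exact: lhomP. Qed.
Next Obligation. by move=> *; exact: lhomP. Qed.
Next Obligation. by move=> *; exact: lhomP. Qed.
Next Obligation. by move=> *; exact: lhomP. Qed.
Next Obligation. by move=> *; apply: lhomP => x; exact: linearD. Qed.

Section HomTensor.
Variables (R S : pzRingType) (X : bimodType R S).

Program Definition hom_functor : functor (LMod R) (LMod S) :=
  @Functor (LMod R) (LMod S) (fun M => bihom X M)
    (fun _ _ f => bihom_map X f) _ _ _.
Next Obligation. by move=> M; apply: lhomP => h; exact: lhomP. Qed.
Next Obligation. by move=> *; apply: lhomP => h; exact: lhomP. Qed.
Next Obligation. by move=> *; apply: lhomP => h; exact: lhomP. Qed.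

Program Definition tensor_functor : functor (LMod S) (LMod R) :=
  @Functor (LMod S) (LMod R) (fun M => bitensor X M)
    (fun _ _ f => bitensor_map X f) _ _ _.
Next Obligation.
by move=> M; apply: bitensor_hom_ext => x m; rewrite bitensor_mapE.
Qed.
Next Obligation.
move=> M N P f g; apply: bitensor_hom_ext => x m.
by rewrite lcompE !bitensor_mapE.
Qed.
Next Obligation.
move=> M N f g; apply: bitensor_hom_ext => x m.
by rewrite lhom_addE !bitensor_mapE lhom_addE tensDr.
Qed.

Fact coev_inner_linear (C : lmodType S) (c : C) :
  linear (fun x : X => tens x c : bitensor X C).
Proof. by move=> a x y; rewrite tensDl bitensorZ. Qed.

Fact coev_linear (C : lmodType S) :
  linear (fun c : C => mklhom (coev_inner_linear c) : bihom X (bitensor X C)).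
Proof.
move=> s c d; apply: lhomP => x.
by rewrite lhom_addE bihom_scaleE !mklhomE tensDr tens_bal.
Qed.

(* c |-> (x |-> x (x) c) *)
Definition coev (C : lmodType S) : lhom C (bihom X (bitensor X C)) :=
  mklhom (@coev_linear C).

Lemma coevE (C : lmodType S) (c : C) (x : X) : coev C c x = tens x c.
Proof. by []. Qed.

Section Eval.
Variable M : lmodType R.

Fact ev_Dl (x y : X) (f : bihom X M) : f (x + y) = f x + f y.
Proof. exact: linearD. Qed.
Fact ev_Dr (x : X) (f g : bihom X M) : (f + g) x = f x + g x.
Proof. by []. Qed.
Fact ev_bal (x : X) (s : S) (f : bihom X M) : f (x *>r s) = (s *: f) x.
Proof. by []. Qed.

Definition ev_fun : bitensor X (bihom X M) -> M :=
  tensor_lift ev_Dl ev_Dr ev_bal.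

Lemma ev_funE x (f : bihom X M) : ev_fun (tens x f) = f x.
Proof. exact: tensor_liftE. Qed.

Fact ev_linear : linear ev_fun.
Proof.
have evD (s t : bitensor X (bihom X M)) : ev_fun (s + t) = ev_fun s + ev_fun t.
  by rewrite /ev_fun [LHS]raddfD.
move=> a s t; rewrite evD; congr (_ + _).
elim/bitensor_ind: s => [x f|s1 s2 H1 H2].
  by rewrite bitensorZ !ev_funE linearZ.
by rewrite scalerDr !evD H1 H2 scalerDr.
Qed.

(* x (x) f |-> f x *)
Definition ev : lhom (bitensor X (bihom X M)) M := mklhom ev_linear.

Lemma evE x (f : bihom X M) : ev (tens x f) = f x.
Proof. exact: ev_funE. Qed.

End Eval.

Program Definition tensor_hom_adjunction :
    adjunction tensor_functor hom_functor :=
  @Adjunction _ _ tensor_functor hom_functor coev ev _ _ _ _.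
Next Obligation.
move=> M N f; apply: lhomP => c; apply: lhomP => x.
by symmetry; exact: (bitensor_mapE f x c).
Qed.
Next Obligation.
move=> M N f; apply: bitensor_hom_ext => x h.
change (f (ev M (tens x h)) =
  ev N (bitensor_map X (bihom_map X f) (tens x h))).
by rewrite bitensor_mapE !evE.
Qed.
Next Obligation.
move=> M; apply: bitensor_hom_ext => x m.
change (ev (bitensor X M) (bitensor_map X (coev M) (tens x m)) = tens x m).
by rewrite bitensor_mapE evE.
Qed.
Next Obligation.
move=> M; apply: lhomP => h; apply: lhomP => x.
exact: (evE x h).
Qed.

End HomTensor.

Section EndoRing.
Variables (C : preadditive) (x : C).

Definition endo : Type := hom x x.

HB.instance Definition _ := GRing.Zmodule.on endo.

Definition endo_mul (f g : endo) : endo := f \c g.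

Fact endo_mulA : associative endo_mul.
Proof. by move=> f g h; exact: mcompA. Qed.
Fact endo_mul1l : left_id (idm x : endo) endo_mul.
Proof. by move=> f; exact: mcomp1m. Qed.
Fact endo_mul1r : right_id (idm x : endo) endo_mul.
Proof. by move=> f; exact: mcompm1. Qed.
Fact endo_mulDl : left_distributive endo_mul +%R.
Proof. by move=> f g h; exact: mcompDl. Qed.
Fact endo_mulDr : right_distributive endo_mul +%R.
Proof. by move=> f g h; exact: mcompDr. Qed.

HB.instance Definition _ := GRing.Zmodule_isPzRing.Build endo
  endo_mulA endo_mul1l endo_mul1r endo_mulDl endo_mulDr.

End EndoRing.

Section RingEpi.
Variables (R U : pzRingType) (u : {rmorphism R -> U}).

Local Notation X := (ringbim u).
Local Notation T := (tensor X X).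

Definition to_bim (x : U) : X := x.

Fact mult_Dl (x y z : X) : (x + y : U) * (z : U) = x * z + y * z.
Proof. exact: mulrDl. Qed.
Fact mult_Dr (x y z : X) : (x : U) * (y + z : U) = x * y + x * z.
Proof. exact: mulrDr. Qed.
Fact mult_bal (x : X) (r : R) (y : X) :
  (x *>r r : U) * (y : U) = (x : U) * (r *: y : U).
Proof. by symmetry; exact: mulrA. Qed.

Definition mult_map : T -> U := tensor_lift mult_Dl mult_Dr mult_bal.

HB.instance Definition _ := GRing.Additive.on mult_map.

Lemma mult_mapE (x y : X) : mult_map (tens x y) = (x : U) * (y : U).
Proof. exact: tensor_liftE. Qed.

Lemma mult_bij_ring_epi : bijective mult_map -> ring_epi u.
Proof.
move=> /bij_inj mi S f g fg.
pose b (x y : X) : S := f x * g y.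
have bDl (x y m : X) : b (x + y) m = b x m + b y m.
  by rewrite /b -mulrDl -rmorphD.
have bDr (x m n : X) : b x (m + n) = b x m + b x n.
  by rewrite /b -mulrDr -rmorphD.
have bb (x : X) (r : R) (m : X) : b (x *>r r) m = b x (r *: m).
  by rewrite /b (rmorphM f x (u r)) (rmorphM g (u r) m) fg mulrA.
move=> x; have e : tens (to_bim 1) (to_bim x) = tens (to_bim x) (to_bim 1).
  by apply: mi; rewrite !mult_mapE mul1r mulr1.
have := congr1 (tensor_lift bDl bDr bb) e.
by rewrite !tensor_liftE /b !rmorph1 mul1r mulr1.
Qed.

(* If u is an epimorphism, the two ring homomorphisms U -> End_Z(U * T) given by
   the diagonal action of U and its conjugate by (y, t) |-> (y, t + 1 (x) y)
   agree on R, hence are equal, so that x (x) y = 1 (x) x y in T. *)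
Section Converse.
Hypothesis u_epi : ring_epi u.

Let V : LMod int := zmodule (U * T)%type.

Fact int_linear (f : V -> V) : zmod_morphism f -> linear f.
Proof.
move=> fB; pose fa : {additive V -> V} :=
  HB.pack f (GRing.isZmodMorphism.Build V V f fB).
by move=> z x y; rewrite -[f]/(fa : _ -> _) raddfD raddfMz.
Qed.

Fact lact_Dl (x : U) (y z m : X) :
  tens (to_bim (x * (y + z))) m = tens (to_bim (x * y)) m + tens (to_bim (x * z)) m :> T.
Proof. by rewrite -tensDl -mulrDr. Qed.
Fact lact_Dr (x : U) (y m n : X) :
  tens (to_bim (x * y)) (m + n) = tens (to_bim (x * y)) m + tens (to_bim (x * y)) n :> T.
Proof. exact: tensDr. Qed.
Fact lact_bal (x : U) (y : X) (r : R) (m : X) :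
  tens (to_bim (x * (y *>r r))) m = tens (to_bim (x * y)) (r *: m) :> T.
Proof.
rewrite -[RHS]/(tens (to_bim (x * y)) (r *: m)).
by apply: (etrans _ (tens_bal _ _ _)); congr tens; exact: mulrA.
Qed.

Definition lact (x : U) : T -> T :=
  tensor_lift (lact_Dl x) (lact_Dr x) (lact_bal x).

HB.instance Definition _ x := GRing.Additive.on (lact x).

Lemma lactE x (y z : X) : lact x (tens y z) = tens (to_bim (x * y)) z.
Proof. exact: tensor_liftE. Qed.

Lemma lactD x y t : lact (x + y) t = lact x t + lact y t.
Proof.
elim/tensor_ind: t => [a b|s t Hs Ht]; first by rewrite !lactE mulrDl tensDl.
by rewrite !raddfD /= Hs Ht; exact: addrACA.
Qed.

Lemma lactM x y t : lact (x * y) t = lact x (lact y t).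
Proof.
elim/tensor_ind: t => [a b|s t Hs Ht]; first by rewrite !lactE mulrA.
by rewrite !raddfD /= Hs Ht.
Qed.

Lemma lact1 t : lact 1 t = t.
Proof.
elim/tensor_ind: t => [a b|s t Hs Ht]; first by rewrite !lactE mul1r.
by rewrite !raddfD /= Hs Ht.
Qed.

Definition twist_deriv (x y : U) : T :=
  tens (to_bim 1) (to_bim (x * y)) - tens (to_bim x) (to_bim y).

Lemma twist_derivBr x y z : twist_deriv x (y - z) = twist_deriv x y - twist_deriv x z.
Proof.
rewrite /twist_deriv mulrBr (tensDr (to_bim 1)) tensNr (tensDr (to_bim x)) tensNr.
by rewrite !opprD !opprK addrACA.
Qed.

Lemma twist_derivDl x y z : twist_deriv (x + y) z = twist_deriv x z + twist_deriv y z.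
Proof. by rewrite /twist_deriv mulrDl (tensDr (to_bim 1)) tensDl opprD addrACA. Qed.

Lemma twist_derivM x y z : twist_deriv (x * y) z = twist_deriv x (y * z) + lact x (twist_deriv y z).
Proof.
by rewrite /twist_deriv raddfB /= !lactE mulr1 mulrA addrA subrK.
Qed.

Definition twist_fun (d : U -> U -> T) (x : U) (v : V) : V :=
  (x * v.1, lact x v.2 + d x v.1).

Section Twist.
Variable d : U -> U -> T.
Hypothesis dBr : forall x y z, d x (y - z) = d x y - d x z.
Hypothesis dDl : forall x y z, d (x + y) z = d x z + d y z.
Hypothesis dM : forall x y z, d (x * y) z = d x (y * z) + lact x (d y z).
Hypothesis d1 : forall y, d 1 y = 0.

Fact twist_additive x : zmod_morphism (twist_fun d x).
Proof.
move=> [a s] [b t]; congr pair => /=; first exact: mulrBr.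
rewrite dBr raddfB /= opprD; exact: addrACA.
Qed.

Definition twist_hom (x : U) : endo V := mklhom (int_linear (twist_additive x)).

Fact twist_hom_is_additive : zmod_morphism twist_hom.
Proof.
have twistD x y : twist_hom (x + y) = twist_hom x + twist_hom y.
  apply: lhomP => -[a t]; congr pair => /=; first exact: mulrDl.
  by rewrite lactD dDl; exact: addrACA.
by move=> x y; apply: (addIr (twist_hom y)); rewrite -twistD !subrK.
Qed.

Fact twist_hom_is_monoid : monoid_morphism twist_hom.
Proof.
split=> [|x y]; apply: lhomP => -[a t]; congr pair => /=.
- exact: mul1r.
- by rewrite lact1 d1 addr0.
- by rewrite mulrA.
- by rewrite lactM dM raddfD /= addrA addrAC.
Qed.

Definition twist : {rmorphism U -> endo V} :=
  HB.pack twist_hom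
    (GRing.isZmodMorphism.Build U (endo V) _ twist_hom_is_additive)
    (GRing.isMonoidMorphism.Build U (endo V) _ twist_hom_is_monoid).

Lemma twistE x v : (twist x : lhom _ _) v = (x * v.1, lact x v.2 + d x v.1).
Proof. by []. Qed.

End Twist.

Lemma ring_epi_tens (x y : U) : tens (to_bim x) (to_bim y) = tens (to_bim 1) (to_bim (x * y)) :> T.
Proof.
pose d0 (_ _ : U) : T := 0.
have z1 (a b c : U) : d0 a (b - c) = d0 a b - d0 a c by rewrite subrr.
have z2 (a b c : U) : d0 (a + b) c = d0 a c + d0 b c by rewrite addr0.
have z3 (a b c : U) : d0 (a * b) c = d0 a (b * c) + lact a (d0 b c).
  by rewrite raddf0 addr0.
have z4 (a : U) : d0 1 a = 0 by [].
have e1 a : twist_deriv 1 a = 0 by rewrite /twist_deriv mul1r subrr.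
have := u_epi (f := twist z1 z2 z3 z4) (g := twist twist_derivBr twist_derivDl twist_derivM e1).
have uE r : twist z1 z2 z3 z4 (u r) = twist twist_derivBr twist_derivDl twist_derivM e1 (u r).
  apply: lhomP => -[a t]; rewrite !twistE /= addr0 /twist_deriv.
  suff -> : tens (to_bim (u r)) (to_bim a) = tens (to_bim 1) (to_bim (u r * a)).
    by rewrite subrr addr0.
  rewrite -[RHS]/(tens (to_bim 1) (r *: to_bim a)) -tens_bal; congr tens.
  by symmetry; exact: mul1r.
move/(_ uE x) => /(congr1 (fun h : endo V => (h : lhom _ _) (y, 0))).
rewrite !twistE /= => -[] /addrI e; apply/esym/eqP.
by rewrite -subr_eq0 -[_ - _]/(twist_deriv x y) -e.
Qed.

Lemma ring_epi_mult_bij : bijective mult_map.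
Proof.
exists (fun y : U => tens (to_bim 1) (to_bim y)) => [t|y]; last first.
  by rewrite mult_mapE mul1r.
elim/tensor_ind: t => [x y|s t Hs Ht].
  by rewrite mult_mapE -ring_epi_tens.
by rewrite raddfD /= (tensDr (to_bim 1)) Hs Ht.
Qed.

End Converse.

Lemma ring_epiP : ring_epi u <-> bijective mult_map.
Proof. by split; [exact: ring_epi_mult_bij | exact: mult_bij_ring_epi]. Qed.

End RingEpi.

(* Main.v *)
Require Import Defs.
From HB Require Import structures.
From mathcomp Require Import all_boot all_order all_algebra.
From mathcomp Require Import boolp.

(** Tensor products, Hom and Ext are taken over R. An R-module J underlies a
    U-module exactly when evaluation at 1 is an isomorphism Hom(U, J) -> J; as u is
    an epimorphism, then also U (x) J = J. The condition Tor_1(U, U) = 0 gives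
    moreover Ext^1(U, J) = 0 (u_local_Ext1), so that an R-module that is an
    extension of one U-module by another is a U-module (u_local_extension), and
    from this Tor_1(U, J) = 0 (u_local_Tor1).

    The equivalence matches the two ways to fill in an exact sequence
      0 -> C -> N -> M -> 0
    whose middle term is a U-module. If M is a divisible comodule, take
    N = Hom(U, M), so that C = Hom(U/R, M). The vanishing of U (x) M and Tor_1(U, M)
    says that N = U (x) C, hence M = N/C = U/R (x) C (ev_bijective). If C is a
    torsionfree contramodule, take N = U (x) C, so that M = U/R (x) C. The vanishing
    of Hom(U, C) and Ext^1(U, C) says that N = Hom(U, M), hence C = Hom(U/R, M)
    (coev_bijective). That C is a contramodule in the first case and M a comodule
    in the second follows from the long exact sequences, as Ext^1(U, N)
    and Tor_1(U, N) vanish. The maps so found to be bijective are the counit and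
    the unit of the adjunction, hence natural.

    Tor_1 and Ext^1 being given by one standard resolution, the portions of the
    long exact sequences that are needed (Tor1_exact, Tor1_quotient, Ext1_lift,
    Ext1_kernel) are obtained by comparing it with an arbitrary presentation of the
    module (resolution_cover). *)

Set Implicit Arguments.
Unset Strict Implicit.
Unset Printing Implicit Defensive.
Import GRing.Theory.
Local Open Scope ring_scope.
Local Open Scope quotient_scope.

Local Notation "X ** f" := (bitensor_map X f) (at level 40).

(** * Linear maps, exactness and quotient modules *)

Section LinearMaps.
Variable R : pzRingType.
Implicit Types A B C M P : lmodType R.

Definition exact A B C (f : lhom A B) (g : lhom B C) : Prop :=
  forall b, g b = 0 <-> exists a, b = f a.

Definition surj (A B : Type) (f : A -> B) : Prop := forall b, exists a, f a = b.

Section LhomLinear.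
Variables (A B : lmodType R) (f : lhom A B).
Lemma lhom0E : f 0 = 0. Proof. exact: linear0. Qed.
Lemma lhomD x y : f (x + y) = f x + f y. Proof. exact: linearD. Qed.
Lemma lhomB x y : f (x - y) = f x - f y. Proof. exact: linearB. Qed.
Lemma lhomZ r x : f (r *: x) = r *: f x. Proof. exact: linearZ. Qed.
End LhomLinear.

Lemma lhom_inj A B (f : lhom A B) : (forall a, f a = 0 -> a = 0) -> injective f.
Proof. by move=> f0 x y fxy; apply/subr0_eq/f0; rewrite linearB fxy subrr. Qed.

Lemma exact_comp0 A B C (f : lhom A B) (g : lhom B C) :
  exact f g -> forall a, g (f a) = 0.
Proof. by move=> fg a; apply/fg; exists a. Qed.

(** Maps defined by arbitrary choices are made linear by choosing inside a
    submodule Q of A * B that meets 0 * B trivially. *)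
Lemma lhom_of_rel A B (Q : A -> B -> Prop) :
    (forall a, exists b, Q a b) -> (forall b, Q 0 b -> b = 0) ->
    (forall r a b a' b', Q a b -> Q a' b' -> Q (r *: a + a') (r *: b + b')) ->
  exists f : lhom A B, forall a, Q a (f a).
Proof.
move=> tot fun0 lin; have [f Qf] := choice tot.
have uniq a b b' : Q a b -> Q a b' -> b = b'.
  move=> Qb Qb'; apply/esym/subr0_eq/fun0.
  by have := lin (-1) _ _ _ _ Qb Qb'; rewrite !scaleN1r addNr addrC.
have fL : linear f by move=> r x y; apply: uniq (Qf _) _; exact: lin.
by exists (mklhom fL).
Qed.

Lemma lift_along_surj A B C (p : lhom A B) (f : lhom A C) :
  surj p -> (forall a, p a = 0 -> f a = 0) ->
  exists g : lhom B C, forall a, g (p a) = f a.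
Proof.
move=> ps pf.
have [g gP] : exists g : lhom B C, forall b, exists2 a, p a = b & f a = g b.
  apply: (lhom_of_rel (Q := fun b c => exists2 a, p a = b & f a = c))
    => [b|c [a pa <-]|r _ _ _ _ [a <- <-] [a' <- <-]].
  - by have [a pa] := ps b; exists (f a), a.
  - exact: pf.
  - by exists (r *: a + a'); rewrite linearP.
exists g => a; have [a' pa' <-] := gP (p a).
by apply/subr0_eq; rewrite -linearB; apply: pf; rewrite linearB pa' subrr.
Qed.

Lemma lift_along_inj A B C (i : lhom A B) (f : lhom C B) :
  injective i -> (forall c, exists a, f c = i a) ->
  exists g : lhom C A, forall c, i (g c) = f c.
Proof.
move=> ii fi.
apply: (lhom_of_rel (Q := fun c a => i a = f c)) => [c|a|r c a c' a' ia ia'].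
- by have [a ->] := fi c; exists a.
- by rewrite linear0 -[RHS in _ = RHS -> _](linear0 i) => /ii.
- by rewrite !linearP ia ia'.
Qed.

Lemma lhom_bij_inv A B (f : lhom A B) : injective f -> surj f ->
  exists g : lhom B A, cancel f g /\ cancel g f.
Proof.
move=> fi fs; have [b|g gP] := @lift_along_inj _ _ _ f (lid B) fi.
  by have [a <-] := fs b; exists a.
by exists g; split=> // a; apply: fi; exact: gP.
Qed.

Definition projective P : Prop :=
  forall A B (p : lhom A B) (f : lhom P B), (forall x, exists a, p a = f x) ->
  exists g : lhom P A, forall x, p (g x) = f x.

Lemma free_projective (K : choiceType) : projective (freemod R K).
Proof.
move=> A B p f pf; have [h hP] := choice (fun k => pf (free_gen R k)).
have ph : p \oL free_lift h = f.
  by apply: free_hom_ext => k; rewrite lcompE free_lift_gen.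
by exists (free_lift h) => x; rewrite -ph.
Qed.

Lemma res0_projective M : projective (res0 M). Proof. exact: free_projective. Qed.
Lemma res1_projective M : projective (res1 M). Proof. exact: free_projective. Qed.
Lemma res2_projective M : projective (res2 M). Proof. exact: free_projective. Qed.

Section Pairing.
Variables (A B C : lmodType R).

Definition lprod : lmodType R := (A * B)%type.

Fact pair_linear (f : lhom C A) (g : lhom C B) :
  linear (fun c : C => (f c, g c) : lprod).
Proof. by move=> r x y; rewrite !linearP. Qed.
Definition lpair f g : lhom C lprod := mklhom (pair_linear f g).

Fact copair_linear (f : lhom A C) (g : lhom B C) :
  linear (fun x : lprod => f x.1 + g x.2).
Proof. by move=> r x y; rewrite !linearP scalerDr addrACA. Qed.
Definition lcopair f g : lhom lprod C := mklhom (copair_linear f g).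

Fact fst_linear : linear (fun x : lprod => x.1). Proof. by []. Qed.
Fact snd_linear : linear (fun x : lprod => x.2). Proof. by []. Qed.
Definition lfst : lhom lprod A := mklhom fst_linear.
Definition lsnd : lhom lprod B := mklhom snd_linear.

Lemma lpairE f g c : lpair f g c = (f c, g c). Proof. by []. Qed.
Lemma lcopairE f g a b : lcopair f g (a, b) = f a + g b. Proof. by []. Qed.
Lemma lfstE a b : lfst (a, b) = a. Proof. by []. Qed.
Lemma lsndE a b : lsnd (a, b) = b. Proof. by []. Qed.
End Pairing.

Definition linl A B : lhom A (lprod A B) := lpair (lid A) 0.
Definition linr A B : lhom B (lprod A B) := lpair 0 (lid B).

Lemma linlE A B a : linl A B a = (a, 0). Proof. by []. Qed.
Lemma linrE A B b : linr A B b = (0, b). Proof. by []. Qed.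

End LinearMaps.

Section QuotientModule.
Variables (R : pzRingType) (A B : lmodType R) (f : lhom A B).

Definition limage : {pred B} := fun b => `[< exists a, b = f a >].

Fact limage_closed : zmod_closed limage.
Proof.
split=> [|x y /asboolP[a ->] /asboolP[b ->]]; apply/asboolP.
  by exists 0; rewrite linear0.
by exists (a - b); rewrite linearB.
Qed.

HB.instance Definition _ := GRing.isZmodClosed.Build B limage limage_closed.

Definition lcoker := Quotient.quot limage.

HB.instance Definition _ := GRing.Zmodule.on lcoker.

Lemma pi_lcoker_eq (x y : B) :
  (\pi_lcoker x == \pi_lcoker y) = (x - y \in limage).
Proof. by rewrite -Quotient.idealrBE. Qed.

Definition lcoker_scale a (x : lcoker) : lcoker := \pi_lcoker (a *: (repr x : B)).

Lemma lcoker_scale_pi a (x : B) :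
  lcoker_scale a (\pi_lcoker x) = \pi_lcoker (a *: x).
Proof.
apply/eqP; rewrite pi_lcoker_eq -scalerBr; apply/asboolP.
have /asboolP[c cE] : (repr (\pi_lcoker x) : B) - x \in limage.
  by rewrite -pi_lcoker_eq reprK.
by exists (a *: c); rewrite linearZ cE.
Qed.

Lemma lcoker_ind (P : lcoker -> Prop) :
  (forall x : B, P (\pi_lcoker x)) -> forall x, P x.
Proof. by move=> H x; rewrite -[x]reprK. Qed.

Fact lcoker_scaleA a b x : lcoker_scale a (lcoker_scale b x) = lcoker_scale (a * b) x.
Proof. by elim/lcoker_ind: x => x; rewrite !lcoker_scale_pi scalerA. Qed.
Fact lcoker_scale1 : left_id 1 lcoker_scale.
Proof. by elim/lcoker_ind => x; rewrite lcoker_scale_pi scale1r. Qed.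
Fact lcoker_scaleDr : right_distributive lcoker_scale +%R.
Proof.
move=> a; elim/lcoker_ind => x; elim/lcoker_ind => y.
by rewrite -raddfD !lcoker_scale_pi scalerDr raddfD.
Qed.
Fact lcoker_scaleDl x : {morph lcoker_scale^~ x : a b / a + b}.
Proof.
by move=> a b; elim/lcoker_ind: x => x; rewrite !lcoker_scale_pi scalerDl raddfD.
Qed.

HB.instance Definition _ := GRing.Zmodule_isLmodule.Build R lcoker
  lcoker_scaleA lcoker_scale1 lcoker_scaleDr lcoker_scaleDl.

Fact lproj_linear : linear (fun b : B => \pi_lcoker b : lcoker).
Proof.
move=> a x y; rewrite raddfD; congr (_ + _).
by symmetry; exact: lcoker_scale_pi.
Qed.

Definition lproj : lhom B lcoker := mklhom lproj_linear.

Lemma lproj_surj : surj lproj.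
Proof. by elim/lcoker_ind => x; exists x. Qed.

Lemma lproj_exact : exact f lproj.
Proof.
move=> b; rewrite /lproj mklhomE -(raddf0 (\pi_lcoker)).
split=> [/eqP|[a ->]]; first by rewrite pi_lcoker_eq subr0 => /asboolP.
by apply/eqP; rewrite pi_lcoker_eq subr0; apply/asboolP; exists a.
Qed.

End QuotientModule.

(** * Right exactness of the tensor product *)

Section TensorExact.
Variables (S R : pzRingType) (X : bimodType S R).
Implicit Types A B C : lmodType R.

Lemma bitensor_map_comp A B C (g : lhom B C) (f : lhom A B) t :
  (X ** g) ((X ** f) t) = (X ** (g \oL f)) t.
Proof.
suff -> : X ** (g \oL f) = (X ** g) \oL (X ** f) by [].
by apply: bitensor_hom_ext => x m; rewrite lcompE !bitensor_mapE.
Qed.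

Lemma bitensor_map_id A t : (X ** lid A) t = t.
Proof.
suff -> : X ** lid A = lid _ by [].
by apply: bitensor_hom_ext => x m; rewrite bitensor_mapE.
Qed.

Lemma eq_bitensor_map A B C (g : lhom B C) (f : lhom A B) (h : lhom A C) t :
  (forall a, g (f a) = h a) -> (X ** g) ((X ** f) t) = (X ** h) t.
Proof. by move=> fh; rewrite bitensor_map_comp; congr ((X ** _) t); exact: lhomP. Qed.

Lemma bitensor_map0 A B t : (X ** (0 : lhom A B)) t = 0.
Proof.
suff -> : X ** (0 : lhom A B) = 0 by [].
by apply: bitensor_hom_ext => x m; rewrite bitensor_mapE lhom_zeroE tens0r.
Qed.

Lemma bitensor_mapD A B (f g : lhom A B) t :
  (X ** (f + g)) t = (X ** f) t + (X ** g) t.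
Proof.
suff -> : X ** (f + g) = X ** f + X ** g by [].
by apply: bitensor_hom_ext => x m; rewrite lhom_addE !bitensor_mapE lhom_addE tensDr.
Qed.

Lemma bitensor_mapN A B (f : lhom A B) t : (X ** (- f)) t = - (X ** f) t.
Proof.
suff -> : X ** (- f) = - (X ** f) by [].
by apply: bitensor_hom_ext => x m; rewrite lhom_oppE !bitensor_mapE lhom_oppE tensNr.
Qed.

(** The inverse of (X (x) B) / im (X (x) f) -> X (x) C sends x (x) c to the class
    of x (x) b for any b over c. *)
Lemma tensor_right_exact A B C (f : lhom A B) (g : lhom B C) :
  surj g -> exact f g -> exact (X ** f) (X ** g).
Proof.
move=> gs fg t; split=> [|[s ->]]; last first.
  rewrite bitensor_map_comp (_ : g \oL f = 0) ?bitensor_map0 //.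
  by apply: lhomP => a; exact: exact_comp0.
have [s sK] := choice gs; pose pi := lproj (X ** f).
have piE x b b' : g b = g b' -> pi (tens x b) = pi (tens x b').
  move=> gb; have /fg[a ab] : g (b - b') = 0 by rewrite linearB gb subrr.
  apply/subr0_eq; rewrite -linearB; apply/lproj_exact; exists (tens x a).
  by rewrite bitensor_mapE -ab tensDr tensNr.
pose h (x : X) c := pi (tens x (s c)).
have hDl x y c : h (x + y) c = h x c + h y c by rewrite /h tensDl linearD.
have hDr x c d : h x (c + d) = h x c + h x d.
  by rewrite /h -linearD -tensDr; apply: piE; rewrite linearD !sK.
have hb x r c : h (x *>r r) c = h x (r *: c).
  by rewrite /h tens_bal; apply: piE; rewrite linearZ !sK.
pose L : bitensor X C -> lcoker (X ** f) := tensor_lift hDl hDr hb.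
have LD s1 s2 : L (s1 + s2) = L s1 + L s2 by exact: raddfD.
have LE (t' : bitensor X B) : L ((X ** g) t') = pi t'.
  elim/bitensor_ind: t' => [x b|t1 t2 IH1 IH2].
    by rewrite bitensor_mapE /L tensor_liftE; apply: piE; rewrite sK.
  by rewrite linearD LD IH1 IH2 linearD.
by move=> gt0; apply/(lproj_exact (X ** f)); rewrite -/pi -LE gt0 /L raddf0.
Qed.

Lemma tensor_pair_inj A B (t : bitensor X (lprod A B)) :
  (X ** lfst A B) t = 0 -> (X ** lsnd A B) t = 0 -> t = 0.
Proof.
move=> t1 t2.
have idE : lid (lprod A B) = (linl A B \oL lfst A B) + (linr A B \oL lsnd A B).
  by apply: lhomP => -[a b]; congr (_, _); rewrite /= ?addr0 ?add0r.
have := bitensor_mapD (linl A B \oL lfst A B) (linr A B \oL lsnd A B) t.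
by rewrite -idE bitensor_map_id -2!bitensor_map_comp t1 t2 2!linear0 addr0.
Qed.

End TensorExact.

(** * Vanishing of Tor_1 and Ext^1 in terms of arbitrary exact sequences *)

Section TorExt.
Variables (S R : pzRingType) (X : bimodType S R).
Implicit Types A B C M N : lmodType R.

(** The standard resolution P of M maps to any presentation A -> B -> M -> 0, by
    g0 : P0 -> B and g1 : P1 -> A. Adding A to P0 makes the map to B surjective,
    with kernel P1 up to the kernel of A -> B. *)
Lemma resolution_cover M A B (j : lhom A B) (p : lhom B M) :
    surj p -> exact j p ->
  exists (g0 : lhom (res0 M) B) (g1 : lhom (res1 M) A),
  [/\ forall q, j (g1 q) = g0 (res_d1 M q), surj (lcopair g0 j) &
      forall e a, lcopair g0 j (e, a) = 0 ->
        exists2 q, e = res_d1 M q & j (a + g1 q) = 0].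
Proof.
move=> ps jp.
have [g0 g0P] := @res0_projective _ M _ _ p (res_aug M) (fun x => ps _).
have [q|g1 g1P] := @res1_projective _ M _ _ j (g0 \oL res_d1 M).
  have /jp[a ->] : p ((g0 \oL res_d1 M) q) = 0; last by exists a.
  by rewrite lcompE g0P -lcompE res_aug_d1.
exists g0, g1; split=> [//|b|e a].
  have [x xb] := res_aug_surj (p b).
  have /jp[a ab] : p (b - g0 x) = 0 by rewrite linearB g0P xb subrr.
  by exists (x, a); rewrite lcopairE -ab addrC subrK.
rewrite lcopairE => ea0.
have [q eq] : exists q, e = res_d1 M q.
  apply: res_d1_exact; rewrite -g0P; move/eqP: ea0; rewrite addr_eq0 => /eqP ->.
  by rewrite linearN (exact_comp0 jp) oppr0.
by exists q => //; rewrite linearD g1P lcompE -eq addrC.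
Qed.

(** With P1 -> A also lifted to g2 : P2 -> K, the sequence P1 + K -> P0 + A -> B
    is exact, so that a class t of X (x) A killed in X (x) B comes from some
    (s1, s2) in X (x) (P1 + K). Here s1 is a cycle, hence the boundary of some s'
    when Tor_1(X, M) = 0, and t is the image of s2 - g2 s'. *)
Lemma Tor1_exact M : Tor1_eq0 X M ->
  forall K A B (k : lhom K A) (j : lhom A B) (p : lhom B M),
  surj p -> exact j p -> exact k j -> exact (X ** k) (X ** j).
Proof.
move=> tor K A B k j p ps jp kj t; split=> [jt0|[s ->]]; last first.
  rewrite (eq_bitensor_map (h := 0)) ?bitensor_map0 //; exact: exact_comp0.
have [g0 [g1 [g1P f0s f0ker]]] := resolution_cover ps jp.
have [q|g2 g2P] := @res2_projective _ M _ _ k (g1 \oL res_d2 M).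
  have /kj[a ->] : j ((g1 \oL res_d2 M) q) = 0; last by exists a.
  by rewrite lcompE g1P -(lcompE (res_d1 M)) res_d1_d2 linear0.
pose f1 : lhom (lprod (res1 M) K) (lprod (res0 M) A) :=
  lpair (res_d1 M \oL lfst _ _) ((k \oL lsnd _ _) - (g1 \oL lfst _ _)).
have f10 : exact f1 (lcopair g0 j).
  case=> e a; split=> [/f0ker[q eq /kj[c cE]]|[[q c] ->]].
    exists (q, c); rewrite lpairE lhom_addE lhom_oppE 3!lcompE lfstE lsndE.
    by rewrite -cE addrK -eq.
  rewrite lpairE lcopairE lhom_addE lhom_oppE 3!lcompE lfstE lsndE linearB g1P.
  by rewrite (exact_comp0 kj) sub0r subrr.
have /(tensor_right_exact f0s f10)[s sE] :
    (X ** lcopair g0 j) ((X ** linr (res0 M) A) t) = 0.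
  rewrite (eq_bitensor_map (h := j)) // => a.
  by rewrite linrE lcopairE linear0 add0r.
have s1 : (X ** res_d1 M) ((X ** lfst _ _) s) = 0.
  have := congr1 (X ** lfst _ _) sE.
  rewrite (eq_bitensor_map (h := 0)) // bitensor_map0 => ->.
  by rewrite !bitensor_map_comp; congr ((X ** _) s); apply: lhomP.
have [s' s'E] := tor _ s1; exists ((X ** lsnd _ _) s - (X ** g2) s').
have := congr1 (X ** lsnd _ _) sE.
rewrite (eq_bitensor_map (h := lid A)) // bitensor_map_id => ->.
rewrite (eq_bitensor_map (h := (k \oL lsnd _ _) - (g1 \oL lfst _ _))) //.
rewrite bitensor_mapD bitensor_mapN -2!bitensor_map_comp linearB; congr (_ - _).
rewrite [(X ** lfst _ _) s]s'E (eq_bitensor_map (h := g1 \oL res_d2 M)) //.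
by rewrite (eq_bitensor_map (h := g1 \oL res_d2 M)).
Qed.

Lemma Tor1_inj M A B (i : lhom A B) (p : lhom B M) :
  Tor1_eq0 X M -> injective i -> surj p -> exact i p -> injective (X ** i).
Proof.
move=> tor ii ps ip; have i0 : exact (0 : lhom A A) i.
  move=> a; split=> [|[b ->]]; last by rewrite lhom_zeroE lhom0E.
  by rewrite -[RHS in _ = RHS -> _](lhom0E i) => /ii ->; exists 0.
apply: lhom_inj => t /(Tor1_exact tor ps ip i0)[s ->]; exact: bitensor_map0.
Qed.

(** This is the exactness of Tor_1(X, B) -> Tor_1(X, M) -> X (x) A -> X (x) B: a
    cycle of X (x) P1 that dies in X (x) A is a cycle for the presentation
    P2 -> P1 -> P0 + A -> B of B, hence a boundary. *)
Lemma Tor1_quotient M A B (i : lhom A B) (p : lhom B M) :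
    injective i -> surj p -> exact i p -> Tor1_eq0 X B -> injective (X ** i) ->
  Tor1_eq0 X M.
Proof.
move=> ii ps ip torB Xi t dt0.
have [g0 [g1 [g1P f0s f0ker]]] := resolution_cover ps ip.
pose f1 : lhom (res1 M) (lprod (res0 M) A) := lpair (res_d1 M) (- g1).
have f10 : exact f1 (lcopair g0 i).
  case=> e a; split=> [/f0ker[q eq iaq]|[q ->]].
    exists q; rewrite lpairE -eq lhom_oppE; congr (_, _).
    by apply/eqP; rewrite -addr_eq0; apply/eqP/ii; rewrite iaq linear0.
  by rewrite lpairE lcopairE lhom_oppE linearN g1P subrr.
have f21 : exact (res_d2 M) f1.
  move=> q; split=> [|[r ->]].
    by case=> /res_d2_exact.
  have d0 : res_d1 M (res_d2 M r) = 0 by rewrite -lcompE res_d1_d2.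
  rewrite lpairE d0; congr (_, _).
  by apply: ii; rewrite lhom_oppE linearN g1P d0 !linear0.
apply/(Tor1_exact torB f0s f10 f21); apply: tensor_pair_inj.
  by rewrite (eq_bitensor_map (h := res_d1 M)).
rewrite (eq_bitensor_map (h := - g1)) // bitensor_mapN.
apply/eqP; rewrite oppr_eq0; apply/eqP/Xi; rewrite linear0.
rewrite (eq_bitensor_map (h := g0 \oL res_d1 M)) // -bitensor_map_comp.
by have -> : (X ** res_d1 M) t = 0 := dt0; rewrite linear0.
Qed.

End TorExt.

Section Ext.
Variable R : pzRingType.
Implicit Types A B C M N : lmodType R.

(** The obstruction to lifting h : M -> C to B lies in Ext^1(M, A): it is the
    cocycle P1 -> A of a lift of P0 -> M -> C to B. *)
Lemma Ext1_lift M A B C (i : lhom A B) (p : lhom B C) :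
    injective i -> exact i p -> Ext1_eq0 M A ->
  forall h : lhom M C, (forall m, exists b, p b = h m) ->
  exists k : lhom M B, forall m, p (k m) = h m.
Proof.
move=> ii ip ext h ph.
have [l lP] := @res0_projective _ M _ _ p (h \oL res_aug M) (fun x => ph _).
have [q|phi phiP] := @lift_along_inj _ _ _ _ i (l \oL res_d1 M) ii.
  by apply/ip; rewrite lcompE lP lcompE -(lcompE (res_aug M)) res_aug_d1 linear0.
have [|g gE] := ext phi.
  apply: lhomP => q; apply: ii; rewrite lcompE phiP lcompE -(lcompE (res_d1 M)).
  by rewrite res_d1_d2 !linear0.
have [x /res_d1_exact[q ->]|k kP] :=
    @lift_along_surj _ _ _ _ (res_aug M) (l - (i \oL g)) (@res_aug_surj _ M).
  by rewrite lhom_addE lhom_oppE lcompE -(lcompE g) -gE phiP subrr.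
exists k => m; have [x <-] := res_aug_surj m.
by rewrite kP lhom_addE lhom_oppE linearB lP lcompE lcompE (exact_comp0 ip) subr0.
Qed.

(** This is the exactness of Hom(M, B) -> Hom(M, C) -> Ext^1(M, A) -> Ext^1(M, B). *)
Lemma Ext1_kernel M A B C (i : lhom A B) (p : lhom B C) :
    injective i -> exact i p -> Ext1_eq0 M B ->
    (forall h : lhom M C, exists k : lhom M B, forall m, p (k m) = h m) ->
  Ext1_eq0 M A.
Proof.
move=> ii ip ext pM f fd0.
have [|g gE] := ext (i \oL f).
  apply: lhomP => q; rewrite !lcompE -(lcompE f) fd0; exact: linear0.
have [x /res_d1_exact[q ->]|h hP] :=
    @lift_along_surj _ _ _ _ (res_aug M) (p \oL g) (@res_aug_surj _ M).
  by rewrite lcompE -(lcompE g) -gE (exact_comp0 ip).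
have [k kP] := pM h.
have [x|g' g'P] := @lift_along_inj _ _ _ _ i (g - (k \oL res_aug M)) ii.
  by apply/ip; rewrite lhom_addE lhom_oppE linearB lcompE kP hP subrr.
exists g'; apply: lhomP => q; apply: ii.
rewrite lcompE g'P lhom_addE lhom_oppE lcompE -(lcompE (res_aug M)) res_aug_d1.
by rewrite -(lcompE g) -gE lhom_zeroE linear0 subr0.
Qed.

End Ext.

(** * U-modules among the R-modules *)

Section RingBimodule.
Variables (R U : pzRingType) (u : {rmorphism R -> U}).

(** Naming the bimodule gives its elements a single type, through which all its
    algebraic structures are inferred. *)
Definition ubim : bimodType R R := ringbim u.

Implicit Types (x y z : ubim) (r : R).

Definition uone : ubim := to_bim u 1.
Definition umul x y : ubim := to_bim u ((x : U) * (y : U)).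

Lemma umul1l x : umul uone x = x. Proof. exact: (mul1r (x : U)). Qed.
Lemma umul1r x : umul x uone = x. Proof. exact: (mulr1 (x : U)). Qed.
Lemma umulDl x y z : umul (x + y) z = umul x z + umul y z.
Proof. exact: (mulrDl (x : U) y z). Qed.
Lemma umulDr x y z : umul x (y + z) = umul x y + umul x z.
Proof. exact: (mulrDr (x : U) y z). Qed.
Lemma umulZl r x y : umul (r *: x) y = r *: umul x y.
Proof. by symmetry; exact: (mulrA (u r) (x : U) y). Qed.
Lemma umulZr r x y : umul x (y *>r r) = umul x y *>r r.
Proof. exact: (mulrA (x : U) y (u r)). Qed.
Lemma umul_bal r x y : umul (x *>r r) y = umul x (r *: y).
Proof. by symmetry; exact: (mulrA (x : U) (u r) y). Qed.
Lemma uoneC r : uone *>r r = r *: uone.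
Proof. by transitivity (u r : ubim); [exact: mul1r | symmetry; exact: mulr1]. Qed.

Lemma epi_tens x y :
  ring_epi u -> tens x y = tens uone (umul x y) :> bitensor ubim ubim.
Proof. by move=> u_epi; exact: (ring_epi_tens u_epi x y). Qed.

End RingBimodule.

Section ULocal.
Variables (R U : pzRingType) (u : {rmorphism R -> U}).
Implicit Types J M N C : lmodType R.

Local Notation X := (ubim u).
Local Notation one := (uone u).

Fact eval1_linear J : linear (fun f : bihom X J => f one).
Proof. by move=> r f g; rewrite lhom_addE bihom_scaleE uoneC linearZ. Qed.

Definition eval1 J : lhom (bihom X J) J := mklhom (@eval1_linear J).

Lemma eval1E J (f : bihom X J) : eval1 J f = f one. Proof. by []. Qed.

Fact to_tensor_linear C : linear (fun c : C => tens one c : bitensor X C).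
Proof. by move=> r c d; rewrite tensDr bitensorZ -tens_bal uoneC. Qed.

Definition to_tensor C : lhom C (bitensor X C) := mklhom (@to_tensor_linear C).

Lemma to_tensorE C c : to_tensor C c = tens one c. Proof. by []. Qed.

(** The R-modules J that underlie a U-module, without a choice of the latter: the
    section a of evaluation at 1 is j |-> (x |-> x j). When u is an epimorphism,
    evaluation at 1 is injective on Hom_R(U, J), so this section is its inverse
    and the U-module structure is unique. *)
Definition u_local J : Prop :=
  exists a : lhom J (bihom X J), forall j, a j one = j.

Lemma u_localP J : injective (eval1 J) -> surj (eval1 J) -> u_local J.
Proof. by move=> i s; have [a [_ aK]] := lhom_bij_inv i s; exists a. Qed.

Lemma u_local_hom M : exists2 a : lhom (bihom X M) (bihom X (bihom X M)),
  (forall f x y, a f x y = f (umul y x)) & forall f, a f one = f.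
Proof.
have inL x (f : bihom X M) : linear (fun y : X => f (umul y x)).
  by move=> r y z; rewrite umulDl umulZl linearP.
have outL f : linear (fun x : X => mklhom (inL x f) : bihom X M).
  move=> r x z; apply: lhomP => y; rewrite lhom_addE bihom_scaleE !mklhomE.
  by rewrite umulDr linearD umul_bal.
have aL : linear (fun f => mklhom (outL f) : bihom X (bihom X M)).
  move=> r f g; apply: lhomP => x; rewrite lhom_addE bihom_scaleE !mklhomE.
  apply: lhomP => y; rewrite mklhomE lhom_addE bihom_scaleE.
  by rewrite -umulZr.
exists (mklhom aL) => [f x y //|f]; apply: lhomP => y.
by rewrite !mklhomE umul1r.
Qed.

Lemma u_local_restr (N : lmodType U) : u_local (restr u N).
Proof.
have inL (n : restr u N) : linear (fun x : X => (x : U) *: (n : N) : restr u N).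
  move=> r x y; apply: (etrans (scalerDl (n : N) (u r * x : U) (y : U))).
  by rewrite -scalerA.
have aL : linear (fun n => mklhom (inL n) : bihom X (restr u N)).
  move=> r n m; apply: lhomP => x; rewrite lhom_addE bihom_scaleE !mklhomE.
  by apply: (etrans (scalerDr (x : U) (u r *: (n : N)) (m : N))); rewrite scalerA.
by exists (mklhom aL) => n; exact: (scale1r (n : N)).
Qed.

Lemma u_local_tensor C :
  exists2 a : lhom (bitensor X C) (bihom X (bitensor X C)),
  (forall x c y, a (tens x c) y = tens (umul y x) c) & forall t, a t one = t.
Proof.
have inL (x : X) (c : C) : linear (fun y : X => tens (umul y x) c : bitensor X C).
  by move=> r y z; rewrite umulDl umulZl tensDl bitensorZ.
pose b x c : bihom X (bitensor X C) := mklhom (inL x c).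
have bDl x y c : b (x + y) c = b x c + b y c.
  by apply: lhomP => z; rewrite lhom_addE !mklhomE umulDr tensDl.
have bDr x c d : b x (c + d) = b x c + b x d.
  by apply: lhomP => z; rewrite lhom_addE !mklhomE tensDr.
have bb x r c : b (x *>r r) c = b x (r *: c).
  by apply: lhomP => z; rewrite !mklhomE umulZr tens_bal.
pose L : bitensor X C -> bihom X (bitensor X C) := tensor_lift bDl bDr bb.
have LD s t : L (s + t) = L s + L t by exact: raddfD.
have LE x c : L (tens x c) = b x c by exact: tensor_liftE.
have LL : linear L.
  move=> r s t; rewrite LD; congr (_ + _).
  elim/bitensor_ind: s => [x c|s1 s2 IH1 IH2]; last first.
    by rewrite scalerDr !LD IH1 IH2 scalerDr.
  rewrite bitensorZ !LE; apply: lhomP => y.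
  by rewrite bihom_scaleE !mklhomE umul_bal.
exists (mklhom LL) => [x c y|]; first by rewrite mklhomE LE.
elim/bitensor_ind => [x c|s t IHs IHt].
  by rewrite mklhomE LE mklhomE umul1l.
by rewrite linearD lhom_addE IHs IHt.
Qed.

Lemma is_divisible_surj M : is_divisible u M -> surj (eval1 M).
Proof.
case=> N [f fs] m; have [n <-] := fs m; have [a a1] := u_local_restr N.
by exists (f \oL a n); rewrite eval1E lcompE a1.
Qed.

End ULocal.

Section ULocalEpi.
Variables (R U : pzRingType) (u : {rmorphism R -> U}).
Hypothesis u_epi : ring_epi u.
Implicit Types J M N C : lmodType R.

Local Notation X := (ubim u).
Local Notation one := (uone u).

(** Apply U (x) f to y (x) x = y x (x) 1. *)
Lemma tens_lhom J (f : lhom X J) x y :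
  tens y (f x) = tens (umul y x) (f one) :> bitensor X J.
Proof.
have fE z w : (X ** f) (tens z w) = tens z (f w) by exact: bitensor_mapE.
by rewrite -2!fE (epi_tens y x u_epi) (epi_tens _ one u_epi) umul1r.
Qed.

(** The action U (x) J -> J of U on a U-module is bijective, with inverse
    j |-> 1 (x) j, and R-linear maps from U to J are multiplications. *)
Lemma u_local_act J : u_local u J -> exists act : lhom (bitensor X J) J,
  [/\ forall j, act (tens one j) = j, forall t, t = tens one (act t) &
      forall (f : lhom X J) x, f x = act (tens x (f one))].
Proof.
case=> a a1; exists (ev X J \oL (X ** a)).
have actE x j : (ev X J \oL (X ** a)) (tens x j) = a j x.
  by rewrite lcompE bitensor_mapE evE.
split=> [j||f x]; first by rewrite actE.
- elim/bitensor_ind => [x j|s t IHs IHt]; last by rewrite linearD tensDr -IHs -IHt.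
  by rewrite actE tens_lhom umul1l a1.
- by rewrite -[x in tens x _]umul1l -tens_lhom actE a1.
Qed.

Lemma u_local_hom_ext J (f g : lhom X J) :
  u_local u J -> f one = g one -> f = g.
Proof.
move=> /u_local_act[act [_ _ actE]] fg1; apply: lhomP => x.
by rewrite [LHS]actE fg1 -actE.
Qed.

Section TorUU.
Hypothesis Tor1_U_U : Tor1_eq0 X X.

(** Let P be the resolution of U. A cocycle f : P1 -> J extends to a map
    F : U (x) P1 -> J. As Tor_1(U, U) = 0 and U (x) U = U, the sequence
    U (x) P2 -> U (x) P1 -> U (x) P0 -> U is exact. With [1] the basis element of P0
    over 1, x |-> x (x) [1] splits its end, so w |-> w - aug w (x) [1] projects
    U (x) P0 onto the image of U (x) P1; F induces a map on this image, and its
    composite with P0 -> U (x) P0 has coboundary f. *)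
Lemma u_local_Ext1 J : u_local u J -> Ext1_eq0 X J.
Proof.
move=> /u_local_act[act [act1 _ _]] f fd0.
pose F := act \oL (X ** f); pose g1 := free_gen R one : res0 X.
have augg1 : res_aug X g1 = one by exact: free_lift_gen.
have Fker t : (X ** res_d1 X) t = 0 -> F t = 0.
  case/Tor1_U_U => s ->; rewrite lcompE.
  rewrite (eq_bitensor_map (h := 0)) ?bitensor_map0 ?linear0 // => q.
  by rewrite -lcompE fd0.
pose w : lhom (res0 X) (bitensor X (res0 X)) :=
  to_tensor u (res0 X) - (coev X (res0 X) g1 \oL res_aug X).
have wE p : w p = tens one p - @tens R X _ (res_aug X p) g1 by [].
have ex : exact (X ** res_d1 X) (X ** res_aug X).
  apply: tensor_right_exact; first exact: res_aug_surj.
  by move=> b; split=> [/res_d1_exact|[q ->]] //; rewrite -lcompE res_aug_d1.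
(* This is 1 (x) x = x (x) 1 in U (x) U. *)
have w0 p : (X ** res_aug X) (w p) = 0.
  rewrite wE lhomB [X in X - _]bitensor_mapE [X in _ - X]bitensor_mapE augg1.
  rewrite [X in X - _](epi_tens _ _ u_epi) [X in _ - X](epi_tens _ _ u_epi).
  by rewrite umul1l umul1r subrr.
have [|||g gP] := @lhom_of_rel R (res0 X) J
    (fun p j => exists2 t, (X ** res_d1 X) t = w p & F t = j).
- by move=> p; have /ex[t tE] := w0 p; exists (F t), t.
- by move=> j [t tE <-]; apply: Fker; rewrite tE lhom0E.
- move=> r p j p' j' [t tE <-] [t' tE' <-]; exists (r *: t + t').
    by rewrite !lhomD !lhomZ tE tE'.
  by rewrite lhomD lhomZ.
exists g; apply: lhomP => q; rewrite lcompE.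
have [t tE <-] := gP (res_d1 X q).
have -> : f q = F (tens one q) by rewrite lcompE bitensor_mapE act1.
apply/subr0_eq; rewrite -lhomB; apply: Fker; rewrite lhomB tE wE bitensor_mapE.
by rewrite -(lcompE (res_aug X)) res_aug_d1 lhom_zeroE tens0l subr0 subrr.
Qed.

(** As Ext^1(U, J) = 0, Hom_R(U, -) keeps J -> E -> N exact, and evaluation at 1
    is bijective on E because it is so on J and N. *)
Lemma u_local_extension J E N (i : lhom J E) (p : lhom E N) :
  injective i -> surj p -> exact i p -> u_local u J -> u_local u N -> u_local u E.
Proof.
move=> ii ps ip uJ uN; apply: u_localP => [|x].
  apply: lhom_inj => f f1; have pf0 : p \oL f = 0.
    by apply: u_local_hom_ext => //; rewrite lcompE -eval1E f1 linear0.
  have [x|g gP] := @lift_along_inj _ _ _ _ i f ii.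
    by apply/ip; rewrite -lcompE pf0.
  suff g0 : g = 0 by apply: lhomP => x; rewrite -gP g0 linear0.
  by apply: u_local_hom_ext => //; apply: ii; rewrite gP linear0 -eval1E f1.
have [aN aN1] := uN; have [aJ aJ1] := uJ.
have [m|k kP] := Ext1_lift ii ip (u_local_Ext1 uJ) (h := aN (p x)).
  exact: ps.
have /ip[j jE] : p (x - k one) = 0 by rewrite linearB kP aN1 subrr.
exists (k + (i \oL aJ j)); rewrite eval1E lhom_addE lcompE aJ1 -jE.
by rewrite addrC subrK.
Qed.

(** Let P be the resolution of N and push the extension Z -> P0 -> N, where Z is
    P1/im P2, out along Z -> U (x) Z. The result E is an extension of U-modules,
    hence a U-module, and the U-linear extension U (x) P0 -> E of P0 -> E restricts
    to the injection of U (x) Z into E. So U (x) Z -> U (x) P0 is injective, which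
    makes the cycles of U (x) P1 boundaries. *)
Lemma u_local_Tor1 N : u_local u N -> Tor1_eq0 X N.
Proof.
move=> uN t dt0.
pose pi := lproj (res_d2 N); set Z := lcoker (res_d2 N) in pi *.
pose J : lmodType R := bitensor X Z.
have [aJ aJE aJ1] := u_local_tensor u Z.
have uJ : u_local u J by exists aJ.
pose k : lhom (res1 N) (lprod (res0 N) J) :=
  lpair (res_d1 N) (- (to_tensor u Z \oL pi)).
pose E : lmodType R := lcoker k.
pose i : lhom J E := lproj k \oL linr _ _.
pose theta : lhom (res0 N) E := lproj k \oL linl _ _.
have [x /lproj_exact[q ->]|p pE] :=
    @lift_along_surj _ _ _ _ (lproj k) (res_aug N \oL lfst _ _)
      (@lproj_surj _ _ _ k).
  by rewrite lcompE lpairE lfstE -(lcompE (res_aug N)) res_aug_d1.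
have ii : injective i.
  apply: lhom_inj => j; rewrite lcompE => /lproj_exact[q].
  rewrite linrE lpairE => kq.
  have /res_d2_exact/lproj_exact pi0 : res_d1 N q = 0 := esym (congr1 fst kq).
  have -> : j = (- (to_tensor u Z \oL pi)) q := congr1 snd kq.
  by rewrite lhom_oppE lcompE [pi q]pi0 lhom0E oppr0.
have ps : surj p.
  move=> n; have [x <-] := res_aug_surj n.
  by exists (lproj k (x, 0)); rewrite pE lcompE lfstE.
have ip : exact i p.
  move=> y; have [[x j] <-] := @lproj_surj _ _ _ k y; split=> [|[j' ->]].
    rewrite pE lcompE lfstE => /res_d1_exact[q qE].
    exists (j + to_tensor u Z (pi q)); apply/subr0_eq; rewrite lcompE -linearB.
    apply/lproj_exact; exists q; rewrite linrE lpairE lhom_oppE lcompE -qE.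
    by congr (_, _); rewrite /= ?subr0 // opprD addrA subrr sub0r.
  by rewrite lcompE pE lcompE linrE lfstE linear0.
have uE : u_local u E := u_local_extension ii ps ip uJ uN.
have [act [_ _ actE]] := u_local_act uE.
have thetaE q : theta (res_d1 N q) = i (to_tensor u Z (pi q)).
  apply/subr0_eq; rewrite 2!lcompE -linearB; apply/lproj_exact; exists q.
  rewrite linlE linrE lpairE lhom_oppE lcompE.
  by congr (_, _); rewrite /= ?subr0 ?sub0r.
(* On U (x) Z, the U-linear extension of theta is the inclusion i: for fixed z,
   both are R-linear in x, and they agree at x = 1. *)
have actJ z : act ((X ** (i \oL to_tensor u Z)) z) = i z.
  elim/bitensor_ind: z => [x z|s1 s2 IH1 IH2]; last by rewrite !linearD IH1 IH2.
  have := actE (i \oL aJ (to_tensor u Z z)) x.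
  by rewrite bitensor_mapE !lcompE aJ1 => <-; rewrite aJE umul1r.
have exP : exact (X ** res_d2 N) (X ** pi).
  exact: tensor_right_exact (@lproj_surj _ _ _ _) (@lproj_exact _ _ _ _).
apply/exP; apply: ii; rewrite -actJ linear0.
rewrite (eq_bitensor_map (h := theta \oL res_d1 N)); last first.
  by move=> q; exact: esym (thetaE q).
rewrite -bitensor_map_comp; have -> : (X ** res_d1 N) t = 0 := dt0.
by rewrite !linear0.
Qed.

End TorUU.
End ULocalEpi.

(** * Divisible and torsionfree modules *)

Section RightAction.
Variables (R U : pzRingType) (u : {rmorphism R -> U}).

(** U as an R-U-bimodule, so that Hom_R(U, M) is a left U-module. *)
Definition uright : Type := ringbim u.

HB.instance Definition _ := GRing.Lmodule.on uright.

Definition uright_scale (x : uright) (y : U) : uright := (x : U) * y.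

Fact uright_scaleA x a b : uright_scale (uright_scale x a) b = uright_scale x (a * b).
Proof. by rewrite /uright_scale mulrA. Qed.
Fact uright_scale1 x : uright_scale x 1 = x.
Proof. exact: mulr1. Qed.
Fact uright_scaleDl a : {morph uright_scale^~ a : x y / x + y}.
Proof. by move=> x y; exact: mulrDl. Qed.
Fact uright_scaleDr x : {morph uright_scale x : a b / a + b}.
Proof. by move=> a b; exact: mulrDr. Qed.

HB.instance Definition _ := isRightModule.Build U uright
  uright_scaleA uright_scale1 uright_scaleDl uright_scaleDr.

Fact uright_bimodA (a : R) (x : uright) (b : U) :
  (a *: x : uright) *>r b = a *: (x *>r b : uright).
Proof. by symmetry; exact: mulrA. Qed.

HB.instance Definition _ := isBimodule.Build R U uright uright_bimodA.

Variable M : lmodType R.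

Definition uhom : lmodType U := bihom uright M.

Fact to_uhom_linear :
  linear (fun h : bihom (ubim u) M => (h : lhom uright M) : restr u uhom).
Proof. by move=> r g h; apply: lhomP => x. Qed.

Definition to_uhom : lhom (bihom (ubim u) M) (restr u uhom) :=
  mklhom to_uhom_linear.

Fact of_uhom_linear :
  linear (fun h : restr u uhom => (h : lhom (ubim u) M) : bihom (ubim u) M).
Proof. by move=> r g h; apply: lhomP => x. Qed.

Definition of_uhom : lhom (restr u uhom) (bihom (ubim u) M) :=
  mklhom of_uhom_linear.

Lemma torsionfree_sub_hom A (f : lhom A (bihom (ubim u) M)) :
  injective f -> is_torsionfree u A.
Proof.
move=> fi; exists uhom, (to_uhom \oL f) => x y E; apply: fi; exact: E.
Qed.

Lemma is_divisibleP : is_divisible u M <-> surj (eval1 u M).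
Proof.
split=> [|s]; first exact: is_divisible_surj.
exists uhom, (eval1 u M \oL of_uhom) => m; have [f <-] := s m.
by exists (f : lhom uright M).
Qed.

End RightAction.

(** * Restriction to U and projection to U/R *)

Section Coker.
Variables (R U : pzRingType) (u : {rmorphism R -> U}).

Local Notation X := (ubim u).
Local Notation one := (uone u).

Definition coker_bim : bimodType R R := coker u.
Local Notation K := coker_bim.

Fact coker_proj_linear : linear (fun x : X => \pi_(coker u) x : K).
Proof.
move=> r x y; apply: (etrans (raddfD _ _ _)); congr (_ + _).
by symmetry; exact: coker_lscaleE.
Qed.

Definition coker_proj : lhom X K := mklhom coker_proj_linear.

Lemma coker_proj_rscale x r : coker_proj (x *>r r) = coker_proj x *>r r.
Proof. by symmetry; exact: coker_rscaleE. Qed.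

Lemma coker_proj_surj : surj coker_proj.
Proof. by elim/coker_ind => x; exists x. Qed.

Lemma coker_proj_eq0 x : coker_proj x = 0 <-> exists r, x = r *: one.
Proof.
have -> : coker_proj x = 0 <-> x \in rimage u.
  by rewrite -pi_coker_eq0; exact: (rwP eqP).
split=> [/asboolP[r <-]|[r ->]]; last apply/asboolP; exists r.
  by symmetry; exact: mulr1.
by symmetry; exact: mulr1.
Qed.

Lemma coker_proj_one : coker_proj one = 0.
Proof. by apply/coker_proj_eq0; exists 1; rewrite scale1r. Qed.

Section HomCoker.
Variable M : lmodType R.

Fact coker_pull_linear : linear (fun c : bihom K M => c \oL coker_proj : bihom X M).
Proof.
move=> r c d; apply: lhomP => x.
by rewrite lhom_addE bihom_scaleE !lcompE lhom_addE bihom_scaleE coker_proj_rscale.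
Qed.

Definition coker_pull : lhom (bihom K M) (bihom X M) := mklhom coker_pull_linear.

Lemma coker_pullE c x : coker_pull c x = c (coker_proj x). Proof. by []. Qed.

Lemma coker_pull_inj : injective coker_pull.
Proof.
move=> c d cd; apply: lhomP => y; have [x <-] := coker_proj_surj y.
by rewrite -!coker_pullE cd.
Qed.

Lemma coker_pull_exact : exact coker_pull (eval1 u M).
Proof.
move=> h; split=> [h1|[c ->]]; last by rewrite eval1E coker_pullE coker_proj_one lhom0E.
have [x /coker_proj_eq0[r ->]|c cP] :=
    @lift_along_surj _ _ _ _ coker_proj h coker_proj_surj.
  by rewrite lhomZ -eval1E h1 scaler0.
by exists c; apply: lhomP => x; rewrite coker_pullE cP.
Qed.

End HomCoker.

Section TensorCoker.
Variable C : lmodType R.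

Fact coker_push_Dl (x y : X) (c : C) :
  tens (coker_proj (x + y)) c = tens (coker_proj x) c + tens (coker_proj y) c.
Proof. by rewrite lhomD tensDl. Qed.
Fact coker_push_Dr (x : X) (c d : C) :
  tens (coker_proj x) (c + d) = tens (coker_proj x) c + tens (coker_proj x) d.
Proof. exact: tensDr. Qed.
Fact coker_push_bal (x : X) r (c : C) :
  tens (coker_proj (x *>r r)) c = tens (coker_proj x) (r *: c).
Proof. by rewrite coker_proj_rscale tens_bal. Qed.

Definition coker_push_fun : bitensor X C -> bitensor K C :=
  tensor_lift coker_push_Dl coker_push_Dr coker_push_bal.

Fact coker_push_linear : linear coker_push_fun.
Proof.
have D s t : coker_push_fun (s + t) = coker_push_fun s + coker_push_fun t.
  exact: raddfD.
have E x c : coker_push_fun (tens x c) = tens (coker_proj x) c.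
  exact: tensor_liftE.
move=> r s t; rewrite D; congr (_ + _).
elim/bitensor_ind: s => [x c|s1 s2 IH1 IH2]; last first.
  by rewrite scalerDr !D IH1 IH2 scalerDr.
by rewrite bitensorZ !E lhomZ bitensorZ.
Qed.

Definition coker_push : lhom (bitensor X C) (bitensor K C) :=
  mklhom coker_push_linear.

Lemma coker_pushE x c : coker_push (tens x c) = tens (coker_proj x) c.
Proof. exact: tensor_liftE. Qed.

Lemma coker_push_surj : surj coker_push.
Proof.
elim/bitensor_ind => [y c|s t [s' <-] [t' <-]].
  by have [x <-] := coker_proj_surj y; exists (tens x c); rewrite coker_pushE.
by exists (s' + t'); rewrite lhomD.
Qed.

(** The inverse of (U (x) C) / C -> U/R (x) C sends the class of x, tensored with c,
    to the class of x (x) c. *)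
Lemma coker_push_exact : exact (to_tensor u C) coker_push.
Proof.
move=> t; split=> [|[c ->]]; last first.
  by rewrite to_tensorE coker_pushE coker_proj_one tens0l.
pose pi := lproj (to_tensor u C).
have [s sK] := choice coker_proj_surj.
have piE x y c : coker_proj x = coker_proj y -> pi (tens x c) = pi (tens y c).
  move=> xy; have /coker_proj_eq0[r rE] : coker_proj (x - y) = 0.
    by rewrite lhomB xy subrr.
  apply/subr0_eq; rewrite -lhomB; apply/lproj_exact; exists (r *: c).
  by rewrite to_tensorE -tens_bal uoneC -rE tensDl tensNl.
pose h y c := pi (tens (s y) c).
have hDl x y c : h (x + y) c = h x c + h y c.
  by rewrite /h -lhomD -tensDl; apply: piE; rewrite lhomD !sK.
have hDr x c d : h x (c + d) = h x c + h x d by rewrite /h tensDr lhomD.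
have hb x r c : h (x *>r r) c = h x (r *: c).
  by rewrite /h -tens_bal; apply: piE; rewrite coker_proj_rscale !sK.
pose L : bitensor K C -> lcoker (to_tensor u C) := tensor_lift hDl hDr hb.
have LD s1 s2 : L (s1 + s2) = L s1 + L s2 by exact: raddfD.
have LE (t' : bitensor X C) : L (coker_push t') = pi t'.
  elim/bitensor_ind: t' => [x c|t1 t2 IH1 IH2].
    by rewrite coker_pushE /L tensor_liftE; apply: piE; rewrite sK.
  by rewrite lhomD LD IH1 IH2 lhomD.
by move=> kt0; apply/(lproj_exact (to_tensor u C)); rewrite -/pi -LE kt0 /L raddf0.
Qed.

End TensorCoker.
End Coker.

(** * The modules Hom_R(U/R, M) *)

Section HomSide.
Variables (R U : pzRingType) (u : {rmorphism R -> U}).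
Hypothesis u_epi : ring_epi u.
Hypothesis Tor1_U_U : Tor1_eq0 (ubim u) (ubim u).

Local Notation X := (ubim u).
Local Notation K := (coker_bim u).
Local Notation one := (uone u).

(** f x y = f (y x) 1 = 0, in accordance with
    Hom(U, Hom(U/R, M)) = Hom(U/R (x) U, M) and U/R (x) U = 0. *)
Lemma hom_ubim_hom_coker_eq0 M (f : lhom X (bihom K M)) : f = 0.
Proof.
pose b (y x : X) := f x (coker_proj u y).
have bDl x y c : b (x + y) c = b x c + b y c by rewrite /b !lhomD.
have bDr x c d : b x (c + d) = b x c + b x d by rewrite /b lhomD.
have bb x r c : b (x *>r r) c = b x (r *: c).
  by rewrite /b lhomZ bihom_scaleE coker_proj_rscale.
apply: lhomP => x; apply: lhomP => k; have [y <-] := @coker_proj_surj _ _ u k.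
have := congr1 (tensor_lift bDl bDr bb) (epi_tens y x u_epi).
by rewrite !tensor_liftE /b coker_proj_one lhom0E.
Qed.

(** With C = Hom(U/R, M) and N = Hom(U, M), the sequence C -> N -> M is exact, N is a
    U-module, and every R-linear map U -> M lifts to N along evaluation
    at 1: hence Ext^1(U, N) = 0 gives Ext^1(U, C) = 0. *)
Lemma hom_torsionfree_contramodule M :
  is_divisible_comodule u M -> is_torsionfree_contramodule u (bihom K M).
Proof.
case=> /is_divisible_surj qs _; split; last split.
- exact: torsionfree_sub_hom (@coker_pull_inj _ _ u M).
- exact: hom_ubim_hom_coker_eq0.
have [a aE a1] := u_local_hom u M.
apply: (Ext1_kernel (@coker_pull_inj _ _ u M) (@coker_pull_exact _ _ u M)).
  by apply: u_local_Ext1 => //; exists a.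
by move=> h; exists (a h) => x; rewrite eval1E aE umul1l.
Qed.

(** Let C = Hom(U/R, M) and N = Hom(U, M). Tensoring C -> N -> M with U gives an
    isomorphism U (x) C -> U (x) N = N, as U (x) M and Tor_1(U, M) vanish. Through
    it, U/R (x) C, which is the quotient of U (x) C by C, becomes N/C = M. *)
Lemma ev_bijective M : is_divisible_comodule u M ->
  injective (ev K M) /\ surj (ev K M).
Proof.
case=> /is_divisible_surj qs [UM0 TorM].
have [a aE a1] := u_local_hom u M.
have uN : u_local u (bihom X M) by exists a.
have [act [act1 actK actE]] := u_local_act u_epi uN.
pose i := coker_pull u M.
have i_ex : exact i (eval1 u M) := @coker_pull_exact _ _ u M.
(* The maps U (x) C -> N -> M and U (x) C -> U/R (x) C -> M agree. *)
have sq t : eval1 u M (act ((X ** i) t)) = ev K M (coker_push u _ t).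
  elim/bitensor_ind: t => [x c|s t IHs IHt]; last by rewrite !lhomD IHs IHt.
  by rewrite bitensor_mapE coker_pushE evE -[i c]a1 -actE eval1E aE umul1l.
have Xi_inj : injective (X ** i) := Tor1_inj TorM (@coker_pull_inj _ _ u M) qs i_ex.
split.
  apply: lhom_inj => w; have [t <-] := @coker_push_surj _ _ u _ w.
  rewrite -sq => /i_ex[c cE]; apply/coker_push_exact; exists c; apply: Xi_inj.
  by rewrite (actK ((X ** i) t)) cE to_tensorE bitensor_mapE.
move=> m; have [h <-] := qs m.
have /(tensor_right_exact qs i_ex)[t tE] : (X ** eval1 u M) (tens one h) = 0.
  exact: UM0.
by exists (coker_push u _ t); rewrite -sq -tE act1.
Qed.

End HomSide.

(** * The modules U/R (x) C *)

Section TensorSide.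
Variables (R U : pzRingType) (u : {rmorphism R -> U}).
Hypothesis u_epi : ring_epi u.
Hypothesis Tor1_U_U : Tor1_eq0 (ubim u) (ubim u).

Local Notation X := (ubim u).
Local Notation K := (coker_bim u).
Local Notation one := (uone u).

(** An embedding of C into a U-module N factors as C -> U (x) C -> U (x) N = N. *)
Lemma torsionfree_to_tensor_inj C : is_torsionfree u C -> injective (to_tensor u C).
Proof.
case=> N [f fi]; have [act [act1 _ _]] := u_local_act u_epi (u_local_restr u N).
have fE c : act ((X ** f) (to_tensor u C c)) = f c.
  by rewrite to_tensorE bitensor_mapE act1.
by move=> c d cd; apply: fi; rewrite -!fE cd.
Qed.

(** The action of U on U (x) C provides a retraction. *)
Lemma tensor_to_tensor_inj C : injective (X ** to_tensor u C).
Proof.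
have [a aE a1] := u_local_tensor u C.
have uN : u_local u (bitensor X C) by exists a.
have [act [_ _ actE]] := u_local_act u_epi uN.
suff actK : cancel (X ** to_tensor u C) act by exact: can_inj actK.
elim/bitensor_ind => [x c|s t IHs IHt]; last by rewrite !lhomD IHs IHt.
by rewrite bitensor_mapE to_tensorE -[tens one c]a1 -actE aE umul1r.
Qed.

(** M = U/R (x) C is the quotient of the U-module N = U (x) C by C. In U (x) M,
    y (x) (x (x) c) = y x (x) (1 (x) c) and 1 vanishes in U/R. Finally,
    Tor_1(U, N) = 0 and U (x) C -> U (x) N is injective, so Tor_1(U, M) = 0. *)
Lemma tensor_divisible_comodule C :
  is_torsionfree_contramodule u C -> is_divisible_comodule u (bitensor K C).
Proof.
case=> /torsionfree_to_tensor_inj ii _.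
have [a aE a1] := u_local_tensor u C.
split; last split.
- apply/is_divisibleP => m; have [t <-] := @coker_push_surj _ _ u _ m.
  by exists (coker_push u C \oL a t); rewrite eval1E lcompE a1.
- have XK0 (t : bitensor X (bitensor K C)) : t = 0; last exact: XK0.
  elim/bitensor_ind: t => [y m|s t -> ->]; last by rewrite addr0.
  elim/bitensor_ind: m => [k c|s t IHs IHt]; last by rewrite tensDr IHs IHt addr0.
  have [x <-] := @coker_proj_surj _ _ u k.
  have := @tens_lhom _ _ u u_epi _ (coev K C c \oL coker_proj u) x y.
  by rewrite !lcompE !coevE coker_proj_one tens0l tens0r.
apply: (Tor1_quotient ii (@coker_push_surj _ _ u C) (@coker_push_exact _ _ u C)).
  by apply: u_local_Tor1 => //; exists a.
exact: tensor_to_tensor_inj.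
Qed.

(** Let N = U (x) C and M = U/R (x) C. As Hom(U, C) = 0 = Ext^1(U, C), the exact
    sequence C -> N -> M gives N = Hom(U, N) = Hom(U, M). Inside Hom(U, M), the
    kernel of evaluation at 1 is Hom(U/R, M); inside N it is C. *)
Lemma coev_bijective C : is_torsionfree_contramodule u C ->
  injective (coev K C) /\ surj (coev K C).
Proof.
case=> /torsionfree_to_tensor_inj ii [UC0 ExtC].
have p_ex := @coker_push_exact _ _ u C.
split.
  apply: lhom_inj => c c0.
  have [x|g gP] := @lift_along_inj _ _ _ _ (to_tensor u C) (coev X C c) ii.
    by apply/p_ex; rewrite coevE coker_pushE -coevE c0.
  apply: ii; rewrite lhom0E -[LHS](coevE (X := X)) -gP.
  by have -> : g = 0 := UC0 g; rewrite lhom0E.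
move=> h.
have [x|k kP] := Ext1_lift ii p_ex ExtC (h := h \oL coker_proj u).
  exact: coker_push_surj.
have /p_ex[c cE] : coker_push u C (k one) = 0.
  by rewrite kP lcompE coker_proj_one lhom0E.
have kE : k = coev X C c.
  apply: (u_local_hom_ext u_epi); last by rewrite cE.
  by have [a _ a1] := u_local_tensor u C; exists a.
exists c; apply: lhomP => y; have [x <-] := @coker_proj_surj _ _ u y.
by rewrite -[RHS](lcompE h) -kP kE; symmetry; exact: coker_pushE.
Qed.

End TensorSide.

(** * The equivalence *)

Section NatIso.
Variables (C D : preadditive) (F G : functor C D).

Lemma pointwise_nat_iso (t : forall x, Defs.hom (F x) (G x)) :
    (forall x y (f : Defs.hom x y), t y \c fmap F f = fmap G f \c t x) ->
    (forall x, exists s, s \c t x = idm (F x) /\ t x \c s = idm (G x)) ->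
  inhabited (nat_iso F G).
Proof.
move=> nat inv; constructor.
apply: (@NatIso _ _ F G t (fun x => sval (cid (inv x)))) => [x|x|//].
  by case: (svalP (cid (inv x))).
by case: (svalP (cid (inv x))).
Qed.

Lemma nat_iso_sym : inhabited (nat_iso F G) -> inhabited (nat_iso G F).
Proof.
case=> n; constructor; apply: (@NatIso _ _ G F (iso_from n) (iso_to n)) => [x|x|x y f].
- exact: iso_fromK.
- exact: iso_toK.
rewrite -[LHS]mcompm1 -(iso_fromK n) mcompA -[X in X \c _]mcompA -iso_natural.
by rewrite mcompA iso_toK mcomp1m.
Qed.

End NatIso.

Lemma lhom_iso (R : pzRingType) (A B : lmodType R) (f : lhom A B) :
  injective f -> surj f -> exists s : lhom B A, s \oL f = lid A /\ f \oL s = lid B.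
Proof. by move=> fi /(lhom_bij_inv fi)[s [sK fK]]; exists s; split; exact: lhomP. Qed.

Theorem theorem1p3 (R U : pzRingType) (u : {rmorphism R -> U})
    (u_epi : ring_epi u) (Tor1_U_U : Tor1_eq0 (ringbim u) (ringbim u)) :
  exists (HF : forall M : LMod R, is_divisible_comodule u M ->
                 is_torsionfree_contramodule u (hom_functor (coker u) M))
         (HG : forall C : LMod R, is_torsionfree_contramodule u C ->
                 is_divisible_comodule u (tensor_functor (coker u) C)),
    inverse_equivalences (restrict (hom_functor (coker u)) HF)
                         (restrict (tensor_functor (coker u)) HG).
Proof.
pose adj := tensor_hom_adjunction (coker u).
have HF (M : LMod R) : is_divisible_comodule u M ->
    is_torsionfree_contramodule u (hom_functor (coker u) M).
  exact: hom_torsionfree_contramodule.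
have HG (C : LMod R) : is_torsionfree_contramodule u C ->
    is_divisible_comodule u (tensor_functor (coker u) C).
  exact: tensor_divisible_comodule.
exists HF, HG; set F := restrict _ HF; set G := restrict _ HG; split.
  apply: (@pointwise_nat_iso _ _ (functor_comp G F) (functor_id _)
            (fun x => adj_counit adj (sval x))) => [x y f|[M HM]].
    by symmetry; exact: (adj_counit_natural adj).
  by have [i s] := ev_bijective u_epi HM; exact: lhom_iso.
apply: nat_iso_sym.
apply: (@pointwise_nat_iso _ _ (functor_id _) (functor_comp F G)
          (fun x => adj_unit adj (sval x))) => [x y f|[C HC]].
  exact: (adj_unit_natural adj).
by have [i s] := coev_bijective u_epi HC; exact: lhom_iso.
Qed.
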